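(* In the setting of the context, let $M=M(\boldsymbol\epsilon)$ be a mixed product. Let $S\in K(\mathscr C)$ (resp. $Q\in K(\mathscr C)$) be the coefficient of the highest (resp. lowest) power of $t$ occurring in $[M]_t$. Then $M$ admits a submodule (resp. a quotient) whose class in $K(\mathscr C)$ is $S$ (resp. $Q$).
   Context: **Setting.** $\Bbbk$ is a field, $\otimes=\otimes_{\Bbbk}$. $\Gamma$ is a commutative monoid and $A$ an associative (not necessarily unital) $\Bbbk$-algebra with mutually orthogonal central idempotents $\{1_\gamma\}_{\gamma\in\Gamma}$ such that $A=\bigoplus_\gamma A_\gamma$, $A_\gamma=1_\gamma A$ (for trivial $\Gamma$, $A$ is unital). $A$-modules $M$ are left modules with $M=\bigoplus_\gamma1_\gamma M$. $\varepsilon\colon A\to\Bbbk$ is a non-trivial algebra homomorphism with $\varepsilon(1_\gamma)=\delta_{\gamma,0}$. $B$ is an $(A,A^{\otimes2})$-bimodule with $B=\bigoplus_\gamma 1_\gamma B$, $1_\gamma B=\bigoplus_{\gamma'+\gamma''=\gamma}B(1_{\gamma'}\otimes1_{\gamma''})$, each $B(1_{\gamma'}\otimes1_{\gamma''})$ free of finite rank as a right $A_{\gamma'}\otimes A_{\gamma''}$-module, equipped with isomorphisms $B\otimes_{A^{\otimes2}}(B\otimes A)\simeq B\otimes_{A^{\otimes2}}(A\otimes B)$ and $B\otimes_{A^{\otimes2}}(A\otimes\Bbbk)\simeq B\otimes_{A^{\otimes2}}(\Bbbk\otimes A)\simeq A$ making $A$-modules a $\Bbbk$-linear monoidal category under $M\star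 N=B\otimes_{A^{\otimes2}}(M\otimes N)$. (Example: $A$ a bialgebra, $B=A^{\otimes 2}$, $\star=\otimes$; e.g. $A=U_q(L\mathfrak g)$ a quantum loop algebra.) $\mathscr C$ is a monoidal Serre subcategory of the category of finite-dimensional $A$-modules. **PBW-theory.** For $J\subset\mathbb Z$, $\mathbb N^{\oplus J}$ is the set of finitely supported tuples. A PBW-theory of $\mathscr C$ is a pair of a family $\{L_j\}_{j\in J}$ of simple objects of $\mathscr C$ and a partial order $\preceq$ on $\mathbb N^{\oplus J}$ such that: (1) $M(\boldsymbol d)=\overset{\leftarrow}{\star}_{j\in J}L_j^{\star d_j}$ (larger $j$ to the left) has a simple head $L(\boldsymbol d)$; (2) the $L(\boldsymbol d)$ form a complete irredundant list of simple objects of $\mathscr C$; (3) $[M(\boldsymbol d)]=[L(\boldsymbol d)]+\sum_{\boldsymbol d'\prec\boldsymbol d}P_{\boldsymbol d,\boldsymbol d'}[L(\boldsymbol d')]$ in $K(\mathscr C)$. **Deformation.** $\mathbb O=\Bbbk[\![z]\!]$, $\mathbb K=\Bbbk(\!(z)\!)$, $A_{\mathbb O}=A\otimes\mathbb O$, $A_{\mathbb K}=A\otimes\mathbb K$, $M\star_{\mathbb O}N=B_{\mathbb O}\otimes_{A_{\mathbb O}\otimes_{\mathbb O}A_{\mathbb O}}(M\otimes_{\mathbb O}N)$ with $B_{\mathbb O}=B\otimes\mathbb O$, $M_{\mathbb K}=M\otimes_{\mathbb O}\mathbb K$, $M_0=M\otimes_{\mathbb O}\Bbbk$. A generically commutative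 deformation of $\{L_j\}$ is a family of $A_{\mathbb O}$-modules $\tilde L_j$, finitely generated over $\mathbb O$, with: $\tilde L_j$ free over $\mathbb O$ and $(\tilde L_j)_0\simeq L_j$; for all $i,j$, $(\tilde L_i\star_{\mathbb O}\tilde L_j)_{\mathbb K}\simeq(\tilde L_j\star_{\mathbb O}\tilde L_i)_{\mathbb K}$ and $\mathrm{End}_{A_{\mathbb K}}((\tilde L_i\star_{\mathbb O}\tilde L_j)_{\mathbb K})=\mathbb K\,\mathrm{id}$. The renormalized $R$-matrix $R_{i,j}\colon(\tilde L_i\star_{\mathbb O}\tilde L_j)_{\mathbb K}\to(\tilde L_j\star_{\mathbb O}\tilde L_i)_{\mathbb K}$ is the isomorphism, unique up to $\mathbb O^\times$, with $R_{i,j}(\tilde L_i\star_{\mathbb O}\tilde L_j)\subset\tilde L_j\star_{\mathbb O}\tilde L_i$ and $\not\subset z(\tilde L_j\star_{\mathbb O}\tilde L_i)$. $\alpha(i,j)\in\mathbb N$ is defined by $R_{i,j}R_{j,i}\in\mathbb O^\times z^{\alpha(i,j)}\mathrm{id}$. The deformation is consistent if for $i<j<k$ in $J$ the quantum Yang–Baxter relation $(R_{j,k}\star\mathrm{id})(\mathrm{id}\star R_{i,k})(R_{i,j}\star\mathrm{id})=(\mathrm{id}\star R_{i,j})(R_{i,k}\star\mathrm{id})(\mathrm{id}\star R_{j,k})$ holds up to $\mathbb O^\times$. Fix a PBW-theory of $\mathscr C$ with a consistent generically commutative deformation. **Mixed products and Jantzen filtration.** For $\boldsymbol\epsilon=(\epsilon_1,\dots,\epsilon_d)\in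 J^d$: $M(\boldsymbol\epsilon)=L_{\epsilon_1}\star\cdots\star L_{\epsilon_d}$ (a mixed product), $\tilde M(\boldsymbol\epsilon)=\tilde L_{\epsilon_1}\star_{\mathbb O}\cdots\star_{\mathbb O}\tilde L_{\epsilon_d}$. $J^{\boldsymbol d}$ is the set of sequences in which each $j$ occurs $d_j$ times; $\boldsymbol\epsilon_s$ (resp. $\boldsymbol\epsilon_c$) is its weakly decreasing (resp. increasing) element. The preorder $\lesssim$ on $J^{\boldsymbol d}$ is generated by $\boldsymbol\epsilon\lesssim\boldsymbol\epsilon'$ if $\boldsymbol\epsilon'$ arises from $\boldsymbol\epsilon$ by replacing a consecutive pair $(i,j)$ with $\alpha(i,j)=0$, or $\alpha(i,j)>0$ and $i>j$, by $(j,i)$. For $\boldsymbol\epsilon\lesssim\boldsymbol\epsilon'$, $R_{\boldsymbol\epsilon',\boldsymbol\epsilon}\colon\tilde M(\boldsymbol\epsilon)_{\mathbb K}\to\tilde M(\boldsymbol\epsilon')_{\mathbb K}$ is the composition of the corresponding $\mathrm{id}\star R_{i,j}\star\mathrm{id}$ (well defined up to $\mathbb O^\times$). For $\boldsymbol\epsilon\in J^{\boldsymbol d}$ (then $\boldsymbol\epsilon_s\lesssim\boldsymbol\epsilon\lesssim\boldsymbol\epsilon_c$) and $n\in\mathbb Z$, $$F_nM(\boldsymbol\epsilon)=\mathrm{ev}_{z=0}\Big(\tilde M(\boldsymbol\epsilon)\cap\sum_{k\in\mathbb Z}\big(z^kR_{\boldsymbol\epsilon,\boldsymbol\epsilon_s}\tilde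 M(\boldsymbol\epsilon_s)\cap z^{n-k}R_{\boldsymbol\epsilon_c,\boldsymbol\epsilon}^{-1}\tilde M(\boldsymbol\epsilon_c)\big)\Big)\subset M(\boldsymbol\epsilon),$$ with $\mathrm{ev}_{z=0}\colon\tilde M(\boldsymbol\epsilon)\to\tilde M(\boldsymbol\epsilon)_0=M(\boldsymbol\epsilon)$. Finally $[M(\boldsymbol\epsilon)]_t=\sum_{n\in\mathbb Z}[F_nM(\boldsymbol\epsilon)/F_{n+1}M(\boldsymbol\epsilon)]t^n\in K(\mathscr C)\otimes\mathbb Z[t^{\pm1}]$. *)

(* Defs.v *)
From HB Require Import structures.
From mathcomp Require Import all_boot all_order all_algebra.
From mathcomp Require Import finmap boolp freeg.

Set Implicit Arguments.
Unset Strict Implicit.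
Unset Printing Implicit Defensive.
Import Order.TTheory GRing.Theory Num.Theory.
Local Open Scope ring_scope.

Definition pseries (k : fieldType) : Type := nat -> k.

Section PowerSeries.
Variable k : fieldType.
Implicit Types f g h : pseries k.

HB.instance Definition _ := gen_eqMixin (pseries k).
HB.instance Definition _ := gen_choiceMixin (pseries k).

Definition ps_const (c : k) : pseries k := fun n => if n is 0 then c else 0.
Definition ps_add f g : pseries k := fun n => f n + g n.
Definition ps_opp f : pseries k := fun n => - f n.
Definition ps_mul f g : pseries k := fun n => \sum_(i < n.+1) f i * g (n - i)%N.
Definition ps_z : pseries k := fun n => (n == 1)%:R.

Fact ps_addA : associative ps_add.
Proof. by move=> f g h; apply/funext => n; exact: addrA. Qed.
Fact ps_addC : commutative ps_add.
Proof. by move=> f g; apply/funext => n; exact: addrC. Qed.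
Fact ps_add0 : left_id (ps_const 0) ps_add.
Proof. by move=> f; apply/funext => -[|n]; exact: add0r. Qed.
Fact ps_addN : left_inverse (ps_const 0) ps_opp ps_add.
Proof. by move=> f; apply/funext => -[|n]; exact: addNr. Qed.

HB.instance Definition _ :=
  GRing.isZmodule.Build (pseries k) ps_addA ps_addC ps_add0 ps_addN.

Definition ps_trunc N f : {poly k} := \poly_(i < N.+1) f i.

Fact ps_mulE N f g n : (n <= N)%N ->
  ps_mul f g n = (ps_trunc N f * ps_trunc N g)`_n.
Proof.
move=> nN; rewrite coefM; apply: eq_bigr => i _.
have iN : (i < N.+1)%N by rewrite ltnS (leq_trans _ nN) // -ltnS.
by rewrite !coef_poly iN ltnS (leq_trans (leq_subr _ _) nN).
Qed.

Fact ps_mulC : commutative ps_mul.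
Proof. by move=> f g; apply/funext=> n; rewrite !(ps_mulE _ _ (leqnn n)) mulrC. Qed.
Fact ps_mulA : associative ps_mul.
Proof.
move=> f g h; apply/funext => n.
transitivity ((ps_trunc n f * ps_trunc n g * ps_trunc n h)`_n); last first.
  rewrite coefM; apply: eq_bigr => i _; rewrite -ps_mulE; last by rewrite -ltnS.
  by rewrite coef_poly ltnS leq_subr.
rewrite -mulrA coefM; apply: eq_bigr => i _; rewrite -ps_mulE ?leq_subr //.
by rewrite coef_poly ltn_ord.
Qed.
Fact ps_mul1 : left_id (ps_const 1) ps_mul.
Proof.
move=> f; apply/funext => n; rewrite /ps_mul big_ord_recl /= mul1r subn0.
by rewrite big1 ?addr0 // => i _; rewrite mul0r.
Qed.
Fact ps_mulDl : left_distributive ps_mul ps_add.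
Proof.
move=> f g h; apply/funext => n; rewrite /ps_mul /ps_add -big_split /=.
by apply: eq_bigr => i _; rewrite mulrDl.
Qed.
Fact ps_1neq0 : ps_const 1 != 0.
Proof. by apply/eqP => /(congr1 (fun f : pseries k => f 0)); apply/eqP/oner_neq0. Qed.

HB.instance Definition _ := GRing.Zmodule_isComNzRing.Build (pseries k)
  ps_mulA ps_mulC ps_mul1 ps_mulDl ps_1neq0.

Definition ps_unit : {pred pseries k} := fun f => `[< exists g, g * f = 1 >].
Definition ps_inv f : pseries k :=
  if pselect (exists g, g * f = 1) is left h then projT1 (cid h) else f.

Fact ps_mulVr : {in ps_unit, left_inverse 1 ps_inv *%R}.
Proof.
move=> f /asboolP uf; rewrite /ps_inv; case: pselect => // h; exact: (projT2 (cid h)).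
Qed.
Fact ps_unitP f g : g * f = 1 -> ps_unit f.
Proof. by move=> gf; apply/asboolP; exists g. Qed.
Fact ps_invr_out : {in [predC ps_unit], ps_inv =1 id}.
Proof.
by move=> f /asboolPn nf; rewrite /ps_inv; case: pselect => // /nf.
Qed.

HB.instance Definition _ :=
  GRing.ComNzRing_hasMulInverse.Build (pseries k) ps_mulVr ps_unitP ps_invr_out.

Fact ps_order f : f != 0 -> exists n, f n != 0 /\ forall m, (m < n)%N -> f m = 0.
Proof.
move=> f0; have ex : exists n, f n != 0.
  apply: contrapT => h; move/eqP: f0; apply; apply/funext => n.
  apply/eqP; case: n => [|n]; apply/negPn/negP => fn; apply: h.
    by exists 0%N.
  by exists n.+1.
case: (ex_minnP ex) => n fn nmin; exists n; split=> // m mn.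
by apply/eqP/negPn/negP => /nmin; rewrite leqNgt mn.
Qed.

Fact ps_integral f g : f * g = 0 -> (f == 0) || (g == 0).
Proof.
move=> fg; apply/negPn/negP; rewrite negb_or => /andP[/ps_order [m [fm mf]]].
move=> /ps_order [n [gn ng]].
have /eqP : ps_mul f g (m + n)%N = 0.
  by rewrite -[ps_mul f g]/(f * g) fg; case: (m + n)%N.
rewrite /ps_mul.
have mlt : (m < (m + n).+1)%N by rewrite ltnS leq_addr.
rewrite (bigD1 (Ordinal mlt)) //= addKn big1.
  by rewrite addr0 mulf_eq0 (negPf fm) (negPf gn).
move=> i; rewrite -val_eqE /= neq_ltn => /orP[im|mi]; first by rewrite mf // mul0r.
rewrite ng ?mulr0 // ltn_subLR; last by rewrite -ltnS.
by rewrite ltn_add2r.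
Qed.

HB.instance Definition _ := GRing.ComUnitRing_isIntegral.Build (pseries k) ps_integral.

Fact ps_const_zmod : zmod_morphism ps_const.
Proof. by move=> a b; apply/funext => -[|n] //=; exact: esym (subrr _). Qed.
HB.instance Definition _ := GRing.isZmodMorphism.Build k (pseries k) ps_const ps_const_zmod.
Fact ps_const_monoid : monoid_morphism ps_const.
Proof.
split=> // a b; apply/funext => n; rewrite -[RHS]/(ps_mul _ _ n) /ps_mul big_ord_recl /=.
rewrite big1 ?addr0; first by case: n => [//|n]; rewrite mulr0.
by move=> i _; rewrite mul0r.
Qed.
HB.instance Definition _ :=
  GRing.isMonoidMorphism.Build k (pseries k) ps_const ps_const_monoid.

Definition ps_ev0 f : k := f 0.
Fact ps_ev0_zmod : zmod_morphism ps_ev0. Proof. by []. Qed.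
HB.instance Definition _ := GRing.isZmodMorphism.Build (pseries k) k ps_ev0 ps_ev0_zmod.
Fact ps_ev0_monoid : monoid_morphism ps_ev0.
Proof. by split=> // f g; exact: big_ord1. Qed.
HB.instance Definition _ :=
  GRing.isMonoidMorphism.Build (pseries k) k ps_ev0 ps_ev0_monoid.

End PowerSeries.

(* Commutative k-algebras R over which A-modules and their products are extended. *)
Record base_ring (k : fieldType) := BaseRing {
  br_ring :> comNzRingType;
  br_in : {rmorphism k -> br_ring} }.

Record base_morph (k : fieldType) (R R' : base_ring k) := BaseMorph {
  bm_fun :> {rmorphism R -> R'};
  bm_in : forall c, bm_fun (br_in R c) = br_in R' c }.

Section BaseRings.
Variable k : fieldType.

Definition Bk : base_ring k := BaseRing (idfun : {rmorphism k -> k}).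
Definition BO : base_ring k := BaseRing (@ps_const k : {rmorphism k -> pseries k}).
(* k((z)) is taken to be the fraction field of k[[z]]. *)
Definition BK : base_ring k :=
  BaseRing (@tofrac (pseries k) \o @ps_const k : {rmorphism k -> {fraction pseries k}}).

Definition bm_id (R : base_ring k) : base_morph R R :=
  @BaseMorph k R R (idfun : {rmorphism R -> R}) (fun _ => erefl).
Fact bm_str_subproof (R : base_ring k) (c : Bk) : br_in R (br_in Bk c) = br_in R c.
Proof. by []. Qed.
Definition bm_str (R : base_ring k) : base_morph Bk R :=
  BaseMorph (@bm_str_subproof R).
Definition bm_ev0 : base_morph BO Bk :=
  @BaseMorph k BO Bk (@ps_ev0 k : {rmorphism pseries k -> k}) (fun _ => erefl).
Definition bm_OK : base_morph BO BK :=
  @BaseMorph k BO BK (@tofrac (pseries k) : {rmorphism pseries k -> {fraction pseries k}})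
    (fun _ => erefl).

End BaseRings.

Section LinearQuotient.
Variables (R : comNzRingType) (V : lmodType R) (S : V -> Prop).

Inductive span : V -> Prop :=
| span0 : span 0
| span_cons a x y : S x -> span y -> span (a *: x + y).

Fact spanD x y : span x -> span y -> span (x + y).
Proof.
elim=> [|a u v Su _ ih sy]; first by rewrite add0r.
by rewrite -addrA; constructor=> //; apply: ih.
Qed.
Fact spanZ a x : span x -> span (a *: x).
Proof.
elim=> [|b u v Su _ ih]; first by rewrite scaler0; constructor.
by rewrite scalerDr scalerA; constructor.
Qed.
Fact span_gen x : S x -> span x.
Proof. by move=> Sx; rewrite -[x]scale1r -[_ *: _]addr0; do !constructor. Qed.

Definition in_span : V -> bool := fun v => `[< span v >].
Fact in_span_closed : zmod_closed in_span.
Proof.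
split=> [|x y]; first by apply/asboolP; constructor.
rewrite /in_mem /= => /asboolP sx /asboolP sy; apply/asboolP.
by rewrite -scaleN1r; apply: spanD => //; apply: spanZ.
Qed.
HB.instance Definition _ := GRing.isZmodClosed.Build V in_span in_span_closed.

Local Notation spanI := (GRing.ZmodClosed.clone V in_span _).
Definition lquot := Quotient.quot spanI.
HB.instance Definition _ := GRing.Zmodule.on lquot.
Definition lproj (v : V) : lquot := (\pi_(Quotient.quot spanI) v)%qT.
Definition lrepr (q : lquot) : V := repr (q : Quotient.quot spanI).

Fact lprojP x y : lproj x = lproj y <-> span (x - y).
Proof.
split=> [/eqP|h].
  by rewrite /lproj -Quotient.idealrBE => /asboolP.
by apply/eqP; rewrite -Quotient.idealrBE; apply/asboolP.
Qed.
Fact lprojK q : lproj (lrepr q) = q.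
Proof. exact: reprK. Qed.
Fact lprojD x y : lproj (x + y) = lproj x + lproj y.
Proof. exact: Quotient.pi_add. Qed.

Fact lproj0 : lproj 0 = 0.
Proof. by apply: (addIr (lproj 0)); rewrite -lprojD !add0r. Qed.

Definition lquot_scale a (q : lquot) : lquot := lproj (a *: lrepr q).
Fact lquot_scaleE a v : lquot_scale a (lproj v) = lproj (a *: v).
Proof.
apply/lprojP; rewrite -scalerBr; apply: spanZ; apply/lprojP; exact: lprojK.
Qed.
Fact lquot_scaleA a b q : lquot_scale a (lquot_scale b q) = lquot_scale (a * b) q.
Proof. by rewrite -[q]lprojK !lquot_scaleE scalerA. Qed.
Fact lquot_scale1 : left_id 1 lquot_scale.
Proof. by move=> q; rewrite -[q]lprojK lquot_scaleE scale1r. Qed.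
Fact lquot_scaleDr : right_distributive lquot_scale +%R.
Proof.
move=> a p q; rewrite -[p]lprojK -[q]lprojK -lprojD !lquot_scaleE -lprojD.
by rewrite scalerDr.
Qed.
Fact lquot_scaleDl q : {morph lquot_scale^~ q : a b / a + b}.
Proof. by move=> a b; rewrite -[q]lprojK !lquot_scaleE -lprojD scalerDl. Qed.
HB.instance Definition _ := GRing.Zmodule_isLmodule.Build R lquot
  lquot_scaleA lquot_scale1 lquot_scaleDr lquot_scaleDl.

Fact lprojZ a x : lproj (a *: x) = a *: lproj x.
Proof. by rewrite /GRing.scale /= lquot_scaleE. Qed.

End LinearQuotient.

Definition restr_type (R R' : comNzRingType) (phi : {rmorphism R -> R'})
  (W : lmodType R') : Type := W.
Arguments restr_type {R R'} phi W.

Section Restriction.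
Variables (R R' : comNzRingType) (phi : {rmorphism R -> R'}) (W : lmodType R').
Local Notation restr := (restr_type phi W).
HB.instance Definition _ := GRing.Zmodule.on restr.
Definition restr_scale (a : R) (w : restr) : restr := phi a *: (w : W).
Fact restr_scaleA a b w : restr_scale a (restr_scale b w) = restr_scale (a * b) w.
Proof. by rewrite /restr_scale rmorphM scalerA. Qed.
Fact restr_scale1 : left_id 1 restr_scale.
Proof. by move=> w; rewrite /restr_scale rmorph1 scale1r. Qed.
Fact restr_scaleDr : right_distributive restr_scale +%R.
Proof. by move=> a v w; rewrite /restr_scale scalerDr. Qed.
Fact restr_scaleDl w : {morph restr_scale^~ w : a b / a + b}.
Proof. by move=> a b; rewrite /restr_scale rmorphD scalerDl. Qed.
HB.instance Definition _ := GRing.Zmodule_isLmodule.Build R restr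
  restr_scaleA restr_scale1 restr_scaleDr restr_scaleDl.
Fact restrZE a (w : restr) : a *: w = (phi a *: (w : W)) :> W.
Proof. by []. Qed.
End Restriction.

Section Presentation.
Variables (R : comNzRingType) (X : choiceType) (rel : {freeg X / R} -> Prop).

Definition pres := lquot rel.
HB.instance Definition _ := GRing.Lmodule.on pres.
Definition gen (x : X) : pres := lproj rel << x >>.

Fact pres_ind (P : pres -> Prop) :
  P 0 -> (forall a x y, P y -> P (a *: gen x + y)) -> forall q, P q.
Proof.
move=> P0 PS q; rewrite -[q]lprojK -[lrepr q]freeg_sumE.
elim: (dom _) => [|x s ih].
  by rewrite big_nil lproj0.
rewrite big_cons lprojD; set c := coeff _ _.
have -> : << c *g x >> = c *: << x >> :> {freeg X / R}.
  by apply/eqP/freeg_eqP => y; rewrite coeffZ !coeffU mul1r.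
by rewrite lprojZ; apply: PS.
Qed.

Fact pres_rel0 f : rel f -> lproj rel f = 0.
Proof.
by move=> rf; rewrite -(lproj0 rel); apply/lprojP; rewrite subr0; apply: span_gen.
Qed.

Section Lift.
Variables (R' : comNzRingType) (phi : {rmorphism R -> R'}) (W : lmodType R').
Variable f : X -> W.

Definition free_lift : {freeg X / R} -> restr_type phi W :=
  fglift (f : X -> restr_type phi W).

Fact free_liftU x : free_lift << x >> = f x.
Proof. by rewrite /free_lift liftU scale1r. Qed.
Fact free_liftB x y : free_lift (x - y) = free_lift x - free_lift y :> W.
Proof. exact: (@lift_is_additive R X (restr_type phi W) f x y). Qed.
Fact free_lift0 : free_lift 0 = 0 :> W.
Proof. by rewrite -(subrr 0) free_liftB subrr. Qed.
Fact free_liftD x y : free_lift (x + y) = free_lift x + free_lift y :> W.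
Proof.
have lN z : free_lift (- z) = - free_lift z :> W.
  by rewrite -[- z]add0r free_liftB free_lift0 add0r.
by rewrite -{1}[y]opprK free_liftB lN opprK.
Qed.
Fact free_liftZ a x : free_lift (a *: x) = phi a *: (free_lift x : W) :> W.
Proof.
have lS (I : Type) (s : seq I) (F : I -> {freeg X / R}) :
    free_lift (\sum_(i <- s) F i) = \sum_(i <- s) (free_lift (F i) : W) :> W.
  elim: s => [|i s ih]; last by rewrite !big_cons free_liftD ih.
  by rewrite !big_nil free_lift0.
rewrite -[in RHS](freeg_sumE x) -[in LHS](freeg_sumE x) scaler_sumr !lS.
rewrite scaler_sumr; apply: eq_bigr => y _; set c := coeff _ _.
have -> : a *: << c *g y >> = << a * c *g y >> :> {freeg X / R}.
  by apply/eqP/freeg_eqP => t; rewrite coeffZ !coeffU mulrA.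
by rewrite /free_lift !liftU !restrZE rmorphM scalerA.
Qed.

Hypothesis frel : forall r, rel r -> free_lift r = 0.

Definition pres_lift of (forall r, rel r -> free_lift r = 0) : pres -> W :=
  fun q => free_lift (lrepr q).
Local Notation L := (pres_lift frel).

Fact pres_lift_proj v : L (lproj rel v) = free_lift v.
Proof.
apply/eqP; rewrite -subr_eq0 -free_liftB; apply/eqP.
have /lprojP : lproj rel (lrepr (lproj rel v)) = lproj rel v by exact: lprojK.
elim=> [|a x y rx _ ih]; first exact: free_lift0.
by rewrite free_liftD free_liftZ frel // scaler0 add0r.
Qed.
Fact pres_liftD p q : L (p + q) = L p + L q.
Proof.
by rewrite -[p]lprojK -[q]lprojK -lprojD !pres_lift_proj free_liftD.
Qed.
Fact pres_liftZ a q : L (a *: q) = phi a *: L q.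
Proof. by rewrite -[q]lprojK -lprojZ !pres_lift_proj free_liftZ. Qed.
Fact pres_lift_gen x : L (gen x) = f x.
Proof. by rewrite pres_lift_proj free_liftU. Qed.

End Lift.
End Presentation.

Section Tensor.
Variables (R : comNzRingType) (U V : lmodType R).
Local Notation F := {freeg (U * V)%type / R}.

Inductive tens_rel : F -> Prop :=
| tens_Dl u u' v : tens_rel (<< (u + u', v) >> - << (u, v) >> - << (u', v) >>)
| tens_Dr u v v' : tens_rel (<< (u, v + v') >> - << (u, v) >> - << (u, v') >>)
| tens_Zl a u v : tens_rel (<< (a *: u, v) >> - a *: << (u, v) >>)
| tens_Zr a u v : tens_rel (<< (u, a *: v) >> - a *: << (u, v) >>).

Definition tens : lmodType R := pres tens_rel.
Definition tmk (u : U) (v : V) : tens := gen tens_rel (u, v).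

Definition bilin (W : lmodType R) (f : U -> V -> W) :=
  [/\ forall v, linear (f^~ v) & forall u, linear (f u)].

Fact tens_lift_rel (W : lmodType R) (f : U -> V -> W) : bilin f ->
  forall r, tens_rel r ->
    free_lift (idfun : {rmorphism R -> R}) (fun p => f p.1 p.2) r = 0.
Proof.
case=> fl fr r.
have lD v x y : f (x + y) v = f x v + f y v by rewrite -[x]scale1r fl !scale1r.
have rD u x y : f u (x + y) = f u x + f u y by rewrite -[x]scale1r fr !scale1r.
have l0 v : f 0 v = 0 by apply: (addIr (f 0 v)); rewrite -lD !add0r.
have r0 u : f u 0 = 0 by apply: (addIr (f u 0)); rewrite -rD !add0r.
case=> [u u' v|u v v'|a u v|a u v]; rewrite !(free_liftB, free_liftZ, free_liftU) /=.
- by rewrite lD addrAC addrK subrr.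
- by rewrite rD addrAC addrK subrr.
- by rewrite -[a *: u]addr0 fl l0 addr0 subrr.
- by rewrite -[a *: v]addr0 fr r0 addr0 subrr.
Qed.

Definition tens_lift (W : lmodType R) (f : U -> V -> W) (hf : bilin f) : tens -> W :=
  pres_lift (tens_lift_rel hf).

Fact tens_liftE W f (hf : @bilin W f) u v : tens_lift hf (tmk u v) = f u v.
Proof. exact: pres_lift_gen. Qed.
Fact tens_lift_lin W f (hf : @bilin W f) : linear (tens_lift hf).
Proof. by move=> a x y; rewrite /tens_lift pres_liftD pres_liftZ. Qed.

Fact tens_ind (P : tens -> Prop) :
  P 0 -> (forall a u v y, P y -> P (a *: tmk u v + y)) -> forall t, P t.
Proof. by move=> P0 PS; apply: pres_ind => // a [u v] y; apply: PS. Qed.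

Fact tmkDl u u' v : tmk (u + u') v = tmk u v + tmk u' v.
Proof.
apply/eqP; rewrite -subr_eq0 opprD addrA; apply/eqP.
have /pres_rel0 := tens_Dl u u' v.
by rewrite -!scaleN1r !lprojD !lprojZ !scaleN1r.
Qed.
Fact tmkDr u v v' : tmk u (v + v') = tmk u v + tmk u v'.
Proof.
apply/eqP; rewrite -subr_eq0 opprD addrA; apply/eqP.
have /pres_rel0 := tens_Dr u v v'.
by rewrite -!scaleN1r !lprojD !lprojZ !scaleN1r.
Qed.
Fact tmkZl a u v : tmk (a *: u) v = a *: tmk u v.
Proof.
apply/eqP; rewrite -subr_eq0; apply/eqP.
have /pres_rel0 := tens_Zl a u v.
by rewrite -!scaleN1r !lprojD !lprojZ !scaleN1r.
Qed.
Fact tmkZr a u v : tmk u (a *: v) = a *: tmk u v.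
Proof.
apply/eqP; rewrite -subr_eq0; apply/eqP.
have /pres_rel0 := tens_Zr a u v.
by rewrite -!scaleN1r !lprojD !lprojZ !scaleN1r.
Qed.
End Tensor.

(* A = (+)_g A_g with A_g = 1_g A; the sum is direct by orthogonality of the
   idempotents, so only the existence of finite decompositions is stated. *)
Record lu_algebra (k : fieldType) (Gam : nmodType) := LuAlgebra {
  la_sort :> lmodType k;
  la_mul : la_sort -> la_sort -> la_sort;
  la_mul_bilin : bilin la_mul;
  la_mulA : forall a b c, la_mul a (la_mul b c) = la_mul (la_mul a b) c;
  la_one : Gam -> la_sort;
  la_one_orth : forall g h, la_mul (la_one g) (la_one h) = if g == h then la_one g else 0;
  la_oneC : forall g a, la_mul (la_one g) a = la_mul a (la_one g);
  la_dec : forall a, exists s : seq Gam, uniq s /\ a = \sum_(g <- s) la_mul (la_one g) a }.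

Record augmentation (k : fieldType) (Gam : nmodType) (A : lu_algebra k Gam) :=
Augmentation {
  aug_fun :> A -> k;
  aug_lin : forall (c : k) (a b : A), aug_fun (c *: a + b) = c * aug_fun a + aug_fun b;
  aug_mul : forall a b : A, aug_fun (la_mul a b) = aug_fun a * aug_fun b;
  aug_nontrivial : exists a : A, aug_fun a != 0;
  aug_one : forall g : Gam, aug_fun (la_one A g) = (g == 0)%:R }.

Section Modules.
Variables (k : fieldType) (Gam : nmodType) (A : lu_algebra k Gam).
Implicit Types R : base_ring k.

(* A module over A_R = A (x)_k R, i.e. an R-module with an R-linear action of A
   which is k-bilinear, and which is the (automatically direct) sum of the 1_g M. *)
Record amod R := AMod {
  am_sort :> lmodType R;
  act : A -> am_sort -> am_sort;
  actDl : forall a b m, act (a + b) m = act a m + act b m;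
  actZl : forall (c : k) a m, act (c *: a) m = br_in R c *: act a m;
  actDr : forall a m n, act a (m + n) = act a m + act a n;
  actZr : forall a (r : R) m, act a (r *: m) = r *: act a m;
  actM : forall a b m, act (la_mul a b) m = act a (act b m);
  act_dec : forall m, exists s : seq Gam,
    uniq s /\ m = \sum_(g <- s) act (la_one A g) m }.

Record hom R R' (phi : base_morph R R') (M : amod R) (N : amod R') := Hom {
  hom_fun :> M -> N;
  homD : forall x y, hom_fun (x + y) = hom_fun x + hom_fun y;
  homZ : forall (r : R) x, hom_fun (r *: x) = phi r *: hom_fun x;
  homA : forall a x, hom_fun (act a x) = act a (hom_fun x) }.

Definition mhom R (M N : amod R) := hom (bm_id R) M N.

Definition injective_hom R (M N : amod R) (f : mhom M N) := injective f.
Definition surjective_hom R (M N : amod R) (f : mhom M N) := forall y, exists x, f x = y.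
Definition is_iso R (M N : amod R) (f : mhom M N) := bijective f.

Definition hid R (M : amod R) : mhom M M :=
  @Hom R R (bm_id R) M M id (fun _ _ => erefl) (fun _ _ => erefl) (fun _ _ => erefl).

Section Comp.
Variables (R R' : base_ring k) (phi : base_morph R R').
Variables (M : amod R) (N P : amod R').
Variables (g : mhom N P) (f : hom phi M N).
Fact hcompD x y : g (f (x + y)) = g (f x) + g (f y). Proof. by rewrite !homD. Qed.
Fact hcompZ r x : g (f (r *: x)) = phi r *: g (f x). Proof. by rewrite !homZ. Qed.
Fact hcompA a x : g (f (act a x)) = act a (g (f x)). Proof. by rewrite !homA. Qed.
Definition hcomp : hom phi M P := Hom hcompD hcompZ hcompA.
End Comp.

Section ModuleLemmas.
Variable R : base_ring k.
Variable M : amod R.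
Fact act0r a : act a (0 : M) = 0.
Proof. by apply: (addIr (act a 0)); rewrite -actDr !add0r. Qed.
Fact act0l (m : M) : act 0 m = 0.
Proof. by apply: (addIr (act 0 m)); rewrite -actDl !add0r. Qed.
Fact act_suml (s : seq Gam) (F : Gam -> A) (m : M) :
  act (\sum_(g <- s) F g) m = \sum_(g <- s) act (F g) m.
Proof.
elim: s => [|g s ih]; first by rewrite !big_nil act0l.
by rewrite !big_cons actDl ih.
Qed.
Fact act_sumr (s : seq Gam) (F : Gam -> M) a :
  act a (\sum_(g <- s) F g) = \sum_(g <- s) act a (F g).
Proof.
elim: s => [|g s ih]; first by rewrite !big_nil act0r.
by rewrite !big_cons actDr ih.
Qed.
End ModuleLemmas.

Fact hom0 R R' (phi : base_morph R R') (M : amod R) (N : amod R') (f : hom phi M N) :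
  f 0 = 0.
Proof. by apply: (addIr (f 0)); rewrite -homD !add0r. Qed.
Fact homN R R' (phi : base_morph R R') (M : amod R) (N : amod R') (f : hom phi M N) x :
  f (- x) = - f x.
Proof. by apply: (addIr (f x)); rewrite -homD !addNr hom0. Qed.

Definition punit (s : seq Gam) : A := \sum_(g <- s) la_one A g.

Definition locally (P : A -> Prop) :=
  exists s : seq Gam, forall t, uniq t -> {subset s <= t} -> P (punit t).

Fact locally_and P Q : locally P -> locally Q -> locally (fun e => P e /\ Q e).
Proof.
move=> [s hs] [t ht]; exists (s ++ t) => u uu su; split.
- by apply: hs => // x xs; apply: su; rewrite mem_cat xs.
- by apply: ht => // x xs; apply: su; rewrite mem_cat xs orbT.
Qed.
Fact locally_ex P : locally P -> exists s, uniq s /\ P (punit s).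
Proof.
case=> s hs; exists (undup s); rewrite undup_uniq; split=> //.
by apply: hs; rewrite ?undup_uniq // => x; rewrite mem_undup.
Qed.
Fact locally_mono (P Q : A -> Prop) : (forall e, P e -> Q e) -> locally P -> locally Q.
Proof. by move=> PQ [s hs]; exists s => t ut st; apply/PQ/hs. Qed.

Fact locally_sum (V : zmodType) (e : Gam -> V) (s t : seq Gam) :
  uniq s -> uniq t -> {subset s <= t} -> (forall g, g \notin s -> e g = 0) ->
  \sum_(g <- t) e g = \sum_(g <- s) e g.
Proof.
move=> us ut st e0; rewrite (bigID (mem s)) /= [X in _ + X]big1; last first.
  by move=> g /e0.
rewrite addr0 -big_filter; apply: perm_big; apply: uniq_perm => //.
  exact: filter_uniq.
by move=> x; rewrite mem_filter; apply/andP/idP => [[]//|xs]; rewrite xs st.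
Qed.

Fact punit_mul s g : uniq s ->
  la_mul (la_one A g) (punit s) = if g \in s then la_one A g else 0.
Proof.
have [_ mr] := la_mul_bilin A.
have mD a x y : la_mul a (x + y) = la_mul a x + la_mul a y :> A.
  by rewrite -[x]scale1r mr !scale1r.
have m0 a : la_mul a 0 = 0 :> A by apply: (addIr (la_mul a 0)); rewrite -mD !add0r.
rewrite /punit; elim: s => [|h s ih] /=; first by rewrite big_nil m0.
case/andP=> hs us; rewrite big_cons mD ih // la_one_orth in_cons.
case: eqVneq => [->|_] /=; first by rewrite (negPf hs) addr0.
by rewrite add0r.
Qed.

Fact act_local R (M : amod R) (m : M) : locally (fun e => act e m = m).
Proof.
have [s [us ms]] := act_dec m; exists s => t ut st.
rewrite act_suml (locally_sum us ut st) -?ms // => g gs.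
rewrite ms act_sumr big_seq big1 // => h hs; rewrite -actM la_one_orth.
by case: eqVneq gs => [->|_ _]; rewrite ?hs ?act0l.
Qed.

Fact punitC s a : la_mul (punit s) a = la_mul a (punit s).
Proof.
have [ml mr] := la_mul_bilin A.
have mDr x y z : la_mul x (y + z) = la_mul x y + la_mul x z :> A.
  by rewrite -[y]scale1r mr !scale1r.
have mDl x y z : la_mul (x + y) z = la_mul x z + la_mul y z :> A.
  by rewrite -[x]scale1r ml !scale1r.
have m0r x : la_mul x 0 = 0 :> A by apply: (addIr (la_mul x 0)); rewrite -mDr !add0r.
have m0l x : la_mul 0 x = 0 :> A by apply: (addIr (la_mul 0 x)); rewrite -mDl !add0r.
rewrite /punit; elim: s => [|g s ih]; first by rewrite !big_nil m0r m0l.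
by rewrite !big_cons mDl mDr ih la_oneC.
Qed.

Fact dec_of_local (M : zmodType) (f : A -> M -> M) (m : M) :
  (forall a b m, f (a + b) m = f a m + f b m) ->
  locally (fun e => f e m = m) ->
  exists s : seq Gam, uniq s /\ m = \sum_(g <- s) f (la_one A g) m.
Proof.
move=> fD /locally_ex [s [us sm]]; exists s; split=> //; rewrite -{1}sm /punit.
have f0 : f 0 m = 0 by apply: (addIr (f 0 m)); rewrite -fD !add0r.
elim: s {us sm} => [|g s ih]; first by rewrite !big_nil f0.
by rewrite !big_cons fD ih.
Qed.

Section Regular.
Fact areg_Dl a b (m : A) : la_mul (a + b) m = la_mul a m + la_mul b m.
Proof. by have [ml _] := la_mul_bilin A; rewrite -[a]scale1r ml !scale1r. Qed.
Fact areg_Dr a (m n : A) : la_mul a (m + n) = la_mul a m + la_mul a n.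
Proof. by have [_ mr] := la_mul_bilin A; rewrite -[m]scale1r mr !scale1r. Qed.
Fact areg_Zl (c : k) a (m : A) : la_mul (c *: a) m = c *: la_mul a m.
Proof.
have z : la_mul 0 m = 0 by apply: (addIr (la_mul 0 m)); rewrite -areg_Dl !add0r.
by have [ml _] := la_mul_bilin A; rewrite -[c *: a]addr0 ml z addr0.
Qed.
Fact areg_Zr a (c : k) (m : A) : la_mul a (c *: m) = c *: la_mul a m.
Proof.
have z : la_mul a 0 = 0 by apply: (addIr (la_mul a 0)); rewrite -areg_Dr !add0r.
by have [_ mr] := la_mul_bilin A; rewrite -[c *: m]addr0 mr z addr0.
Qed.
Definition areg : amod (Bk k) :=
  @AMod (Bk k) A (@la_mul _ _ A) areg_Dl areg_Zl areg_Dr areg_Zr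
    (fun a b m => esym (la_mulA a b m)) (@la_dec _ _ A).

Definition aright (a : A) : mhom areg areg :=
  @Hom (Bk k) (Bk k) (bm_id (Bk k)) areg areg (fun x => la_mul x a)
    (fun x y => areg_Dl x y a) (fun c x => areg_Zl c x a)
    (fun b x => esym (la_mulA b x a)).
End Regular.

Section ActHom.
Variables (R : base_ring k) (M : amod R).
Definition acthom (m : M) : hom (bm_str R) areg M :=
  @Hom (Bk k) R (bm_str R) areg M (fun a => act a m)
    (fun a b => actDl a b m) (fun c a => actZl c a m) (fun a b => actM a b m).
End ActHom.

Section UnitObject.
Variables (eps : augmentation A) (R : base_ring k).
Definition unit_act (a : A) (r : (R : comNzRingType)^o) : (R : comNzRingType)^o :=
  br_in R (eps a) * r.
Fact augD (a b : A) : eps (a + b) = eps a + eps b.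
Proof. by rewrite -[a]scale1r aug_lin scale1r mul1r. Qed.
Fact aug0 : eps 0 = 0.
Proof. by apply: (addIr (eps 0)); rewrite -augD !add0r. Qed.
Fact augZ c (a : A) : eps (c *: a) = c * eps a.
Proof. by rewrite -[c *: a]addr0 aug_lin aug0 addr0. Qed.
Fact unit_Dl a b m : unit_act (a + b) m = unit_act a m + unit_act b m.
Proof. by rewrite /unit_act augD rmorphD mulrDl. Qed.
Fact unit_Zl c a m : unit_act (c *: a) m = br_in R c *: unit_act a m.
Proof. by rewrite /unit_act augZ rmorphM -mulrA. Qed.
Fact unit_Dr a m n : unit_act a (m + n) = unit_act a m + unit_act a n.
Proof. exact: mulrDr. Qed.
Fact unit_Zr a r m : unit_act a (r *: m) = r *: unit_act a m.
Proof. exact: mulrCA. Qed.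
Fact unit_M a b m : unit_act (la_mul a b) m = unit_act a (unit_act b m).
Proof. by rewrite /unit_act aug_mul rmorphM mulrA. Qed.
Fact unit_dec m : exists s : seq Gam,
  uniq s /\ m = \sum_(g <- s) unit_act (la_one A g) m.
Proof.
exists [:: 0]; split=> //; rewrite big_seq1 /unit_act aug_one eqxx rmorph1.
by rewrite mul1r.
Qed.
Definition aunit : amod R := AMod unit_Dl unit_Zl unit_Dr unit_Zr unit_M unit_dec.
End UnitObject.

Section UnitMap.
Variables (eps : augmentation A) (R R' : base_ring k) (phi : base_morph R R').
Fact unit_mapA a (r : aunit eps R) : phi (act a r) = act a (phi r : aunit eps R').
Proof. by rewrite /= /unit_act rmorphM bm_in. Qed.
Definition unit_map : hom phi (aunit eps R) (aunit eps R') :=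
  @Hom R R' phi (aunit eps R) (aunit eps R') phi (rmorphD phi) (rmorphM phi) unit_mapA.
End UnitMap.

Section BaseChange.
Variables (R R' : base_ring k) (phi : base_morph R R') (M : amod R).
Local Notation F := {freeg M / R'}.

Inductive bc_rel : F -> Prop :=
| bc_D m n : bc_rel (<< m + n >> - << m >> - << n >>)
| bc_Z r m : bc_rel (<< r *: m >> - phi r *: << m >>).

Definition bc_mod : lmodType R' := pres bc_rel.
Definition bc_gen (m : M) : bc_mod := gen bc_rel m.

Fact bc_genD m n : bc_gen (m + n) = bc_gen m + bc_gen n.
Proof.
apply/eqP; rewrite -subr_eq0 opprD addrA; apply/eqP.
have /pres_rel0 := bc_D m n.
by rewrite -!scaleN1r !lprojD !lprojZ !scaleN1r.
Qed.
Fact bc_genZ r m : bc_gen (r *: m) = phi r *: bc_gen m.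
Proof.
apply/eqP; rewrite -subr_eq0; apply/eqP.
have /pres_rel0 := bc_Z r m.
by rewrite -!scaleN1r !lprojD !lprojZ !scaleN1r.
Qed.
Fact bc_ind (P : bc_mod -> Prop) :
  P 0 -> (forall a m y, P y -> P (a *: bc_gen m + y)) -> forall t, P t.
Proof. by move=> P0 PS; apply: pres_ind. Qed.

Section Lift.
Variables (W : lmodType R') (f : M -> W).
Hypotheses (fD : forall x y, f (x + y) = f x + f y)
  (fZ : forall r x, f (r *: x) = phi r *: f x).
Fact bc_lift_rel r : bc_rel r -> free_lift (idfun : {rmorphism R' -> R'}) f r = 0.
Proof.
case=> [m n|a m]; rewrite !(free_liftB, free_liftZ, free_liftU) /=.
- by rewrite fD addrAC addrK subrr.
- by rewrite fZ subrr.
Qed.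
Definition bc_lift : bc_mod -> W := pres_lift bc_lift_rel.
Fact bc_liftD x y : bc_lift (x + y) = bc_lift x + bc_lift y.
Proof. exact: pres_liftD. Qed.
Fact bc_liftZ r x : bc_lift (r *: x) = r *: bc_lift x.
Proof. exact: pres_liftZ. Qed.
Fact bc_liftE m : bc_lift (bc_gen m) = f m.
Proof. exact: pres_lift_gen. Qed.
End Lift.

Fact bc_actD a x y : bc_gen (act a (x + y)) = bc_gen (act a x) + bc_gen (act a y).
Proof. by rewrite actDr bc_genD. Qed.
Fact bc_actZ a r x : bc_gen (act a (r *: x)) = phi r *: bc_gen (act a x).
Proof. by rewrite actZr bc_genZ. Qed.
Definition bc_act a : bc_mod -> bc_mod := bc_lift (@bc_actD a) (@bc_actZ a).
Fact bc_act_gen a m : bc_act a (bc_gen m) = bc_gen (act a m).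
Proof. exact: bc_liftE. Qed.
Fact bc_act_Dr a x y : bc_act a (x + y) = bc_act a x + bc_act a y.
Proof. exact: bc_liftD. Qed.
Fact bc_act_Zr a r x : bc_act a (r *: x) = r *: bc_act a x.
Proof. exact: bc_liftZ. Qed.
Fact bc_act0 a : bc_act a 0 = 0.
Proof. by apply: (addIr (bc_act a 0)); rewrite -bc_act_Dr !add0r. Qed.
Fact bc_act_Dl a b x : bc_act (a + b) x = bc_act a x + bc_act b x.
Proof.
elim/bc_ind: x => [|r m y ih]; first by rewrite !bc_act0 addr0.
by rewrite !bc_act_Dr !bc_act_Zr !bc_act_gen ih actDl bc_genD scalerDr addrACA.
Qed.
Fact bc_act_Zl c a x : bc_act (c *: a) x = br_in R' c *: bc_act a x.
Proof.
elim/bc_ind: x => [|r m y ih]; first by rewrite !bc_act0 scaler0.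
rewrite !bc_act_Dr !bc_act_Zr !bc_act_gen ih actZl bc_genZ bm_in scalerDr.
by rewrite !scalerA mulrC.
Qed.
Fact bc_act_M a b x : bc_act (la_mul a b) x = bc_act a (bc_act b x).
Proof.
elim/bc_ind: x => [|r m y ih]; first by rewrite !bc_act0.
by rewrite !(bc_act_Dr, bc_act_Zr, bc_act_gen) ih actM.
Qed.
Fact bc_act_dec x : exists s : seq Gam,
  uniq s /\ x = \sum_(g <- s) bc_act (la_one A g) x.
Proof.
apply: dec_of_local; first by move=> a b m; apply: bc_act_Dl.
elim/bc_ind: x => [|r m y ih]; first by exists [::] => t _ _; rewrite bc_act0.
have := locally_and (act_local m) ih; apply: locally_mono => e [em ey].
by rewrite bc_act_Dr bc_act_Zr bc_act_gen em ey.
Qed.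
Definition bc : amod R' :=
  AMod bc_act_Dl bc_act_Zl bc_act_Dr bc_act_Zr bc_act_M bc_act_dec.
Definition bc_in : hom phi M bc :=
  @Hom R R' phi M bc bc_gen bc_genD bc_genZ (fun a m => esym (bc_act_gen a m)).
End BaseChange.

Section BaseChangeMap.
Variables (R R' : base_ring k) (phi : base_morph R R') (M N : amod R) (f : mhom M N).
Fact bc_mapD x y : bc_in phi N (f (x + y)) = bc_in phi N (f x) + bc_in phi N (f y).
Proof. by rewrite !homD. Qed.
Fact bc_mapZ r x : bc_in phi N (f (r *: x)) = phi r *: bc_in phi N (f x).
Proof. by rewrite !homZ. Qed.
Definition bc_map_fun : bc phi M -> bc phi N := bc_lift bc_mapD bc_mapZ.
Fact bc_map_gen m : bc_map_fun (bc_in phi M m) = bc_in phi N (f m).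
Proof. exact: bc_liftE. Qed.
Fact bc_map_D x y : bc_map_fun (x + y) = bc_map_fun x + bc_map_fun y.
Proof. exact: bc_liftD. Qed.
Fact bc_map_Z r x : bc_map_fun (r *: x) = r *: bc_map_fun x.
Proof. exact: bc_liftZ. Qed.
Fact bc_map_A a x : bc_map_fun (act a x) = act a (bc_map_fun x).
Proof.
have z : bc_map_fun 0 = 0.
  by apply: (addIr (bc_map_fun 0)); rewrite -bc_map_D !add0r.
elim/bc_ind: x => [|r m y ih]; first by rewrite act0r z act0r.
rewrite actDr actZr !bc_map_D !bc_map_Z ih actDr actZr.
have -> : act a (bc_gen phi m : bc phi M) = bc_in phi M (act a m) by rewrite homA.
by rewrite bc_map_gen (bc_map_gen m) !homA.
Qed.
Definition bc_map : mhom (bc phi M) (bc phi N) := @Hom R' R' (bm_id R') (bc phi M) (bc phi N) bc_map_fun bc_map_D bc_map_Z bc_map_A.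
End BaseChangeMap.

End Modules.

Section TensorSquare.
Variables (k : fieldType) (Gam : nmodType) (A : lu_algebra k Gam).
Local Notation T := (tens A A).

Fact tmul_in_bilin (a b : A) : bilin (fun a' b' : A => tmk (la_mul a a') (la_mul b b')).
Proof.
split=> [y c x x'|x c y y'].
  by rewrite areg_Dr areg_Zr tmkDl tmkZl.
by rewrite areg_Dr areg_Zr tmkDr tmkZr.
Qed.
Fact tmul_out_bilin (y : T) : bilin (fun a b : A => tens_lift (tmul_in_bilin a b) y).
Proof.
have l0 a b : tens_lift (tmul_in_bilin a b) 0 = 0.
  have := tens_lift_lin (tmul_in_bilin a b) 1 0 0.
  by rewrite !scale1r addr0 => /(congr1 (fun z => z - tens_lift (tmul_in_bilin a b) 0)); rewrite addrK subrr.
split=> [b c a a'|a c b b']; elim/tens_ind: y => [|d u v y ih];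
  rewrite ?l0 ?scaler0 ?addr0 // !tens_lift_lin !tens_liftE ih.
  rewrite areg_Dl areg_Zl tmkDl tmkZl !scalerDr !scalerA [d * c]mulrC.
  by rewrite -!addrA; congr (_ + _); rewrite addrCA.
rewrite areg_Dl areg_Zl tmkDr tmkZr !scalerDr !scalerA [d * c]mulrC.
by rewrite -!addrA; congr (_ + _); rewrite addrCA.
Qed.
Definition tmul (x y : T) : T := tens_lift (tmul_out_bilin y) x.

Definition tone (g h : Gam) : T := tmk (la_one A g) (la_one A h).

(* The right A (x) A-module B (1_g (x) 1_h) is free of finite rank over
   A_g (x) A_h = (1_g (x) 1_h)(A (x) A). *)
Record star_bimod := StarBimod {
  sb_left :> amod A (Bk k);
  ract : sb_left -> T -> sb_left;
  ract_bilin : bilin (ract : (sb_left : lmodType k) -> T -> (sb_left : lmodType k));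
  ractM : forall b s t, ract (ract b s) t = ract b (tmul s t);
  ract_act : forall a b t, act a (ract b t) = ract (act a b) t;
  ract_grade : forall g h b,
    act (la_one A (g + h)) (ract b (tone g h)) = ract b (tone g h);
  ract_dec : forall g b, act (la_one A g) b = b -> exists s : seq (Gam * Gam),
    [/\ uniq s, all (fun p => p.1 + p.2 == g) s
      & b = \sum_(p <- s) ract b (tone p.1 p.2)];
  ract_free : forall g h, exists (r : nat) (e : 'I_r -> sb_left),
    (forall i, ract (e i) (tone g h) = e i) /\
    forall b, ract b (tone g h) = b -> exists! c : {ffun 'I_r -> T},
      (forall i, tmul (tone g h) (c i) = c i) /\ b = \sum_i ract (e i) (c i) }.

End TensorSquare.

Section Star.
Variables (k : fieldType) (Gam : nmodType) (A : lu_algebra k Gam).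
Variable B : star_bimod A.
Implicit Types R : base_ring k.

Fact ractDl (b b' : B) t : ract (b + b') t = ract b t + ract b' t.
Proof. by have [l _] := ract_bilin B; rewrite -[b]scale1r l !scale1r. Qed.
Fact ractDr (b : B) t t' : ract b (t + t') = ract b t + ract b t'.
Proof. by have [_ r] := ract_bilin B; rewrite -[t]scale1r r !scale1r. Qed.
Fact ract0r (b : B) : ract b 0 = 0.
Proof. by apply: (addIr (ract b 0)); rewrite -ractDr !add0r. Qed.
Fact ract0l t : ract (0 : B) t = 0.
Proof. by apply: (addIr (ract 0 t)); rewrite -ractDl !add0r. Qed.
Fact ractZl c (b : B) t : ract (c *: b) t = c *: ract b t.
Proof. by have [l _] := ract_bilin B; rewrite -[c *: b]addr0 l ract0l addr0. Qed.
Fact ractZr c (b : B) t : ract b (c *: t) = c *: ract b t.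
Proof. by have [_ r] := ract_bilin B; rewrite -[c *: t]addr0 r ract0r addr0. Qed.

Definition bright (t : tens A A) : mhom B B :=
  @Hom k Gam A (Bk k) (Bk k) (bm_id (Bk k)) B B (fun b => ract b t)
    (fun x y => ractDl x y t) (fun c x => ractZl c x t) (fun a b => esym (ract_act a b t)).

Section Def.
Variables (R : base_ring k) (M N : amod A R).
Local Notation F := {freeg (B * M * N)%type / R}.

(* Since B_R (x)_(A_R (x)_R A_R) (M (x)_R N) = B (x)_(A (x) A) (M (x)_R N), the
   R-module M *_R N has the generators b (x) m (x) n and the following relations. *)
Inductive star_rel : F -> Prop :=
| star_D1 b b' m n :
    star_rel (<< (b + b', m, n) >> - << (b, m, n) >> - << (b', m, n) >>)
| star_D2 b m m' n :
    star_rel (<< (b, m + m', n) >> - << (b, m, n) >> - << (b, m', n) >>)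
| star_D3 b m n n' :
    star_rel (<< (b, m, n + n') >> - << (b, m, n) >> - << (b, m, n') >>)
| star_Z1 (c : k) b m n :
    star_rel (<< (c *: b, m, n) >> - br_in R c *: << (b, m, n) >>)
| star_Z2 (r : R) b m n :
    star_rel (<< (b, r *: m, n) >> - r *: << (b, m, n) >>)
| star_Z3 (r : R) b m n :
    star_rel (<< (b, m, r *: n) >> - r *: << (b, m, n) >>)
| star_bal b a a' m n :
    star_rel (<< (ract b (tmk a a'), m, n) >> - << (b, act a m, act a' n) >>).

Definition star_mod : lmodType R := pres star_rel.
Definition sg (b : B) (m : M) (n : N) : star_mod := gen star_rel (b, m, n).

Fact sg_D1 b b' m n : sg (b + b') m n = sg b m n + sg b' m n.
Proof.
apply/eqP; rewrite -subr_eq0 opprD addrA; apply/eqP.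
have /pres_rel0 := star_D1 b b' m n.
by rewrite -!scaleN1r !lprojD !lprojZ !scaleN1r.
Qed.
Fact sg_D2 b m m' n : sg b (m + m') n = sg b m n + sg b m' n.
Proof.
apply/eqP; rewrite -subr_eq0 opprD addrA; apply/eqP.
have /pres_rel0 := star_D2 b m m' n.
by rewrite -!scaleN1r !lprojD !lprojZ !scaleN1r.
Qed.
Fact sg_D3 b m n n' : sg b m (n + n') = sg b m n + sg b m n'.
Proof.
apply/eqP; rewrite -subr_eq0 opprD addrA; apply/eqP.
have /pres_rel0 := star_D3 b m n n'.
by rewrite -!scaleN1r !lprojD !lprojZ !scaleN1r.
Qed.
Fact sg_Z1 c b m n : sg (c *: b) m n = br_in R c *: sg b m n.
Proof.
apply/eqP; rewrite -subr_eq0; apply/eqP.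
have /pres_rel0 := star_Z1 c b m n.
by rewrite -!scaleN1r !lprojD !lprojZ !scaleN1r.
Qed.
Fact sg_Z2 r b m n : sg b (r *: m) n = r *: sg b m n.
Proof.
apply/eqP; rewrite -subr_eq0; apply/eqP.
have /pres_rel0 := star_Z2 r b m n.
by rewrite -!scaleN1r !lprojD !lprojZ !scaleN1r.
Qed.
Fact sg_Z3 r b m n : sg b m (r *: n) = r *: sg b m n.
Proof.
apply/eqP; rewrite -subr_eq0; apply/eqP.
have /pres_rel0 := star_Z3 r b m n.
by rewrite -!scaleN1r !lprojD !lprojZ !scaleN1r.
Qed.
Fact sg_bal b a a' m n : sg (ract b (tmk a a')) m n = sg b (act a m) (act a' n).
Proof.
apply/eqP; rewrite -subr_eq0; apply/eqP.
have /pres_rel0 := star_bal b a a' m n.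
by rewrite -!scaleN1r !lprojD !lprojZ !scaleN1r.
Qed.
Fact star_ind (P : star_mod -> Prop) :
  P 0 -> (forall r b m n y, P y -> P (r *: sg b m n + y)) -> forall x, P x.
Proof. by move=> P0 PS; apply: pres_ind => // r [[b m] n] y; apply: PS. Qed.

Section Lift.
Variables (R' : base_ring k) (phi : base_morph R R') (W : lmodType R').
Variable f : B -> M -> N -> W.

Record balanced : Prop := Balanced {
  bal_D1 : forall b b' m n, f (b + b') m n = f b m n + f b' m n;
  bal_D2 : forall b m m' n, f b (m + m') n = f b m n + f b m' n;
  bal_D3 : forall b m n n', f b m (n + n') = f b m n + f b m n';
  bal_Z1 : forall (c : k) b m n, f (c *: b) m n = br_in R' c *: f b m n;
  bal_Z2 : forall r b m n, f b (r *: m) n = phi r *: f b m n;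
  bal_Z3 : forall r b m n, f b m (r *: n) = phi r *: f b m n;
  bal_A : forall b a a' m n, f (ract b (tmk a a')) m n = f b (act a m) (act a' n) }.

Fact star_lift_rel : balanced -> forall r, star_rel r ->
  free_lift phi (fun p => f p.1.1 p.1.2 p.2) r = 0.
Proof.
case=> D1 D2 D3 Z1 Z2 Z3 Al r.
case=> *; rewrite !(free_liftB, free_liftZ, free_liftU) /=.
- by rewrite D1 addrAC addrK subrr.
- by rewrite D2 addrAC addrK subrr.
- by rewrite D3 addrAC addrK subrr.
- by rewrite Z1 bm_in subrr.
- by rewrite Z2 subrr.
- by rewrite Z3 subrr.
- by rewrite Al subrr.
Qed.

Hypothesis fb : balanced.
Definition star_lift : star_mod -> W := pres_lift (star_lift_rel fb).
Fact star_liftD x y : star_lift (x + y) = star_lift x + star_lift y.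
Proof. exact: pres_liftD. Qed.
Fact star_liftZ r x : star_lift (r *: x) = phi r *: star_lift x.
Proof. exact: pres_liftZ. Qed.
Fact star_liftE b m n : star_lift (sg b m n) = f b m n.
Proof. exact: pres_lift_gen. Qed.
Fact star_lift0 : star_lift 0 = 0.
Proof. by apply: (addIr (star_lift 0)); rewrite -star_liftD !add0r. Qed.
End Lift.

Fact star_act_bal a : @balanced R (bm_id R) star_mod (fun b m n => sg (act a b) m n).
Proof.
split=> *.
- by rewrite actDr sg_D1.
- by rewrite sg_D2.
- by rewrite sg_D3.
- by rewrite actZr sg_Z1.
- by rewrite sg_Z2.
- by rewrite sg_Z3.
- by rewrite ract_act sg_bal.
Qed.
Definition star_act a : star_mod -> star_mod := star_lift (star_act_bal a).
Fact star_actE a b m n : star_act a (sg b m n) = sg (act a b) m n.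
Proof. exact: star_liftE. Qed.
Fact star_act_Dr a x y : star_act a (x + y) = star_act a x + star_act a y.
Proof. exact: star_liftD. Qed.
Fact star_act_Zr a r x : star_act a (r *: x) = r *: star_act a x.
Proof. exact: star_liftZ. Qed.
Fact star_act0 a : star_act a 0 = 0.
Proof. exact: star_lift0. Qed.
Fact star_act_Dl a b x : star_act (a + b) x = star_act a x + star_act b x.
Proof.
elim/star_ind: x => [|r c m n y ih]; first by rewrite !star_act0 addr0.
by rewrite !star_act_Dr !star_act_Zr !star_actE ih actDl sg_D1 scalerDr addrACA.
Qed.
Fact star_act_Zl c a x : star_act (c *: a) x = br_in R c *: star_act a x.
Proof.
elim/star_ind: x => [|r b m n y ih]; first by rewrite !star_act0 scaler0.
rewrite !star_act_Dr !star_act_Zr !star_actE ih actZl sg_Z1 scalerDr.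
by rewrite !scalerA mulrC.
Qed.
Fact star_act_M a b x : star_act (la_mul a b) x = star_act a (star_act b x).
Proof.
elim/star_ind: x => [|r c m n y ih]; first by rewrite !star_act0.
by rewrite !(star_act_Dr, star_act_Zr, star_actE) ih actM.
Qed.
Fact star_act_dec x : exists s : seq Gam,
  uniq s /\ x = \sum_(g <- s) star_act (la_one A g) x.
Proof.
apply: dec_of_local; first by move=> a b m; apply: star_act_Dl.
elim/star_ind: x => [|r b m n y ih]; first by exists [::] => t _ _; rewrite star_act0.
have := locally_and (act_local b) ih; apply: locally_mono => e [em ey].
by rewrite star_act_Dr star_act_Zr star_actE em ey.
Qed.
Definition star : amod A R :=
  AMod star_act_Dl star_act_Zl star_act_Dr star_act_Zr star_act_M star_act_dec.
End Def.

Definition sghom R (M N : amod A R) (m : M) (n : N) : hom (bm_str R) B (star M N) :=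
  @Hom k Gam A (Bk k) R (bm_str R) B (star M N) (fun b => sg b m n : star M N)
    (fun b b' => sg_D1 b b' m n) (fun c b => sg_Z1 c b m n)
    (fun a b => esym (star_actE a b m n)).

Section StarMap.
Variables (R R' : base_ring k) (phi : base_morph R R').
Variables (M N : amod A R) (M' N' : amod A R') (f : hom phi M M') (g : hom phi N N').
Fact star_map_bal :
  @balanced R M N R' phi (star M' N') (fun b m n => sg b (f m) (g n)).
Proof.
split=> *.
- by rewrite sg_D1.
- by rewrite homD sg_D2.
- by rewrite homD sg_D3.
- by rewrite sg_Z1.
- by rewrite homZ sg_Z2.
- by rewrite homZ sg_Z3.
- by rewrite sg_bal !homA.
Qed.
Definition star_map_fun : star M N -> star M' N' := star_lift star_map_bal.
Fact star_map_sg b m n : star_map_fun (sg b m n) = sg b (f m) (g n).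
Proof. exact: star_liftE. Qed.
Fact star_map_D x y : star_map_fun (x + y) = star_map_fun x + star_map_fun y.
Proof. exact: star_liftD. Qed.
Fact star_map_Z r x : star_map_fun (r *: x) = phi r *: star_map_fun x.
Proof. exact: star_liftZ. Qed.
Fact star_map_A a x : star_map_fun (act a x) = act a (star_map_fun x).
Proof.
have z : star_map_fun 0 = 0.
  by apply: (addIr (star_map_fun 0)); rewrite -star_map_D !add0r.
elim/star_ind: x => [|r b m n y ih]; first by rewrite act0r z act0r.
rewrite actDr actZr !star_map_D !star_map_Z ih actDr actZr.
have -> : act a (sg b m n : star M N) = sg (act a b) m n by exact: star_actE.
rewrite !star_map_sg.
by have -> : act a (sg b (f m) (g n) : star M' N') = sg (act a b) (f m) (g n) by exact: star_actE.
Qed.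
Definition star_map : hom phi (star M N) (star M' N') :=
  Hom star_map_D star_map_Z star_map_A.
Fact star_mapE b m n : star_map (sg b m n) = sg b (f m) (g n).
Proof. exact: star_map_sg. Qed.
End StarMap.

End Star.

Section Constraints.
Variables (k : fieldType) (Gam : nmodType) (A : lu_algebra k Gam).
Variables (eps : augmentation A) (B : star_bimod A).

(* B (x)_(A^2) (B (x) A) is [star B B (areg A)] with A^3 acting on the right by
   functoriality, and similarly for the other bimodules. *)
Record constraints := Constraints {
  ca : mhom (star B B (areg A)) (star B (areg A) B);
  ca_inv : mhom (star B (areg A) B) (star B B (areg A));
  caK : cancel ca ca_inv;
  ca_invK : cancel ca_inv ca;
  ca_equiv : forall a1 a2 a3 w,
    ca (star_map B (bright B (tmk a1 a2)) (aright a3) w) =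
    star_map B (aright a1) (bright B (tmk a2 a3)) (ca w);
  cr : mhom (star B (areg A) (aunit eps (Bk k))) (areg A);
  cr_iso : is_iso cr;
  cr_equiv : forall a w,
    cr (star_map B (aright a) (hid (aunit eps (Bk k))) w) = aright a (cr w);
  cl : mhom (star B (aunit eps (Bk k)) (areg A)) (areg A);
  cl_iso : is_iso cl;
  cl_equiv : forall a w,
    cl (star_map B (hid (aunit eps (Bk k))) (aright a) w) = aright a (cl w) }.

Variable C : constraints.

Fact ca_inv_equiv a1 a2 a3 w :
  ca_inv C (star_map B (aright a1) (bright B (tmk a2 a3)) w) =
  star_map B (bright B (tmk a1 a2)) (aright a3) (ca_inv C w).
Proof.
by apply: (can_inj (caK C)); rewrite (ca_equiv C) !(ca_invK C).
Qed.

Fact punit_idem s : uniq s -> la_mul (punit A s) (punit A s) = punit A s.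
Proof.
move=> us; rewrite {1}/punit.
have l0 a : la_mul 0 a = 0 :> A.
  by apply: (addIr (la_mul 0 a)); rewrite -areg_Dl !add0r.
have -> (t : seq Gam) a : la_mul (\sum_(g <- t) la_one A g) a = \sum_(g <- t) la_mul (la_one A g) a :> A.
  elim: t => [|g t ih]; first by rewrite !big_nil l0.
  by rewrite !big_cons areg_Dl ih.
by rewrite /punit big_seq [RHS]big_seq; apply: eq_bigr => g gs; rewrite punit_mul // gs.
Qed.

Definition lunit_ex R (M : amod A R) (m : M) := cid (locally_ex (act_local m)).
Definition lunit R (M : amod A R) (m : M) : A := punit A (projT1 (lunit_ex m)).
Fact lunit_act R (M : amod A R) (m : M) : act (lunit m) m = m.
Proof. by have [] := projT2 (lunit_ex m). Qed.
Fact lunit_idem R (M : amod A R) (m : M) : la_mul (lunit m) (lunit m) = lunit m.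
Proof. by apply: punit_idem; have [] := projT2 (lunit_ex m). Qed.
Fact lunitC R (M : amod A R) (m : M) a : la_mul (lunit m) a = la_mul a (lunit m).
Proof. exact: punitC. Qed.

Fact ract_local (b : B) : locally (A := A) (fun e => ract b (tmk e e) = b).
Proof.
have lD x y : locally (A := A) (fun e => ract x (tmk e e) = x) ->
    locally (A := A) (fun e => ract y (tmk e e) = y) ->
    locally (A := A) (fun e => ract (x + y) (tmk e e) = x + y :> B).
  move=> lx ly; apply: locally_mono (locally_and lx ly) => e [ex ey].
  by rewrite ractDl ex ey.
have l0 : locally (A := A) (fun e => ract 0 (tmk e e) = 0 :> B).
  by exists [::] => t _ _; rewrite ract0l.
have lS (I : eqType) (s : seq I) (F : I -> B) :
    (forall i, i \in s -> locally (A := A) (fun e => ract (F i) (tmk e e) = F i)) ->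
    locally (A := A) (fun e => ract (\sum_(i <- s) F i) (tmk e e) = \sum_(i <- s) F i).
  elim: s => [|i s ih] h; first by rewrite big_nil.
  rewrite big_cons; apply: lD; first by apply: h; rewrite mem_head.
  by apply: ih => j js; apply: h; rewrite in_cons js orbT.
have [s [us ->]] := act_dec b; apply: (lS) => g _.
have gg : act (la_one A g) (act (la_one A g) b) = act (la_one A g) b.
  by rewrite -actM la_one_orth eqxx.
have [t [ut _ ->]] := ract_dec gg; apply: (lS) => -[h h'] _ /=.
exists [:: h; h'] => u uu su; rewrite ractM /tone /tmul !tens_liftE !punit_mul //.
by rewrite !su // !inE eqxx ?orbT.
Qed.

(* The isomorphism (M * N) * P -> M * (N * P) induced by [ca]:
   b (x) (b' (x) m (x) n) (x) a p is sent to the image of ca (b (x) b' (x) a) under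
   b (x) a (x) b' |-> b (x) a m (x) (b' (x) n (x) p). *)
Section Associator.
Variables (R : base_ring k) (M N P : amod A R).

Definition as_out (m : M) (n : N) (p : P) :
    hom (bm_str R) (star B (areg A) B) (star B M (star B N P)) :=
  star_map B (acthom m) (sghom B n p).
Fact as_outE m n p b a b' :
  as_out m n p (sg b (a : areg A) b') = sg b (act a m) (sg b' n p : star B N P).
Proof. exact: star_mapE. Qed.

Fact as_out_ind (Q : star B (areg A) B -> Prop) :
  Q 0 -> (forall r b (a : areg A) (b' : B) y, Q y -> Q (r *: (sg b a b' : star B (areg A) B) + y)) ->
  forall w, Q w.
Proof. exact: star_ind. Qed.

Fact as_out_equiv m n p a1 a2 a3 w :
  as_out m n p (star_map B (aright a1) (bright B (tmk a2 a3)) w) =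
  as_out (act a1 m) (act a2 n) (act a3 p) w.
Proof.
elim/as_out_ind: w => [|r b a b' y ih]; first by rewrite !hom0.
rewrite !homD !homZ ih; congr (_ *: _ + _).
by rewrite star_mapE !as_outE /= actM sg_bal.
Qed.
Fact as_outD1 m m' n p w : as_out (m + m') n p w = as_out m n p w + as_out m' n p w.
Proof.
elim/as_out_ind: w => [|r b a b' y ih]; first by rewrite !hom0 addr0.
rewrite !homD !homZ ih !as_outE actDr.
by rewrite sg_D2 scalerDr addrACA.
Qed.
Fact as_outD2 m n n' p w : as_out m (n + n') p w = as_out m n p w + as_out m n' p w.
Proof.
elim/as_out_ind: w => [|r b a b' y ih]; first by rewrite !hom0 addr0.
rewrite !homD !homZ ih !as_outE sg_D2.
by rewrite (sg_D3 b (act a m) (sg b' n p : star B N P)) scalerDr addrACA.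
Qed.
Fact as_outD3 m n p p' w : as_out m n (p + p') w = as_out m n p w + as_out m n p' w.
Proof.
elim/as_out_ind: w => [|r b a b' y ih]; first by rewrite !hom0 addr0.
rewrite !homD !homZ ih !as_outE sg_D3.
by rewrite (sg_D3 b (act a m) (sg b' n p : star B N P)) scalerDr addrACA.
Qed.
Fact as_outZ1 r m n p w : as_out (r *: m) n p w = r *: as_out m n p w.
Proof.
elim/as_out_ind: w => [|s b a b' y ih]; first by rewrite !hom0 scaler0.
rewrite !homD !homZ ih !as_outE actZr sg_Z2.
by rewrite scalerDr !scalerA mulrC.
Qed.
Fact as_outZ2 r m n p w : as_out m (r *: n) p w = r *: as_out m n p w.
Proof.
elim/as_out_ind: w => [|s b a b' y ih]; first by rewrite !hom0 scaler0.
rewrite !homD !homZ ih !as_outE sg_Z2 (sg_Z3 r b (act a m) (sg b' n p : star B N P)).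
by rewrite scalerDr !scalerA mulrC.
Qed.
Fact as_outZ3 r m n p w : as_out m n (r *: p) w = r *: as_out m n p w.
Proof.
elim/as_out_ind: w => [|s b a b' y ih]; first by rewrite !hom0 scaler0.
rewrite !homD !homZ ih !as_outE sg_Z3 (sg_Z3 r b (act a m) (sg b' n p : star B N P)).
by rewrite scalerDr !scalerA mulrC.
Qed.

Definition as_core b b' m n p (a : A) : star B M (star B N P) :=
  as_out m n p (ca C (sg b b' (a : areg A))).

Fact as_core_equiv b b' m n p a a1 a2 a3 :
  as_core b (ract b' (tmk a1 a2)) m n p (la_mul a a3) =
  as_core b b' (act a1 m) (act a2 n) (act a3 p) a.
Proof.
rewrite /as_core -as_out_equiv -ca_equiv.
by rewrite (star_mapE (B := B) (bright B (tmk a1 a2)) (aright a3) b b' a).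
Qed.
Fact as_core_mul b b' m n p a a3 :
  as_core b b' m n p (la_mul a a3) = as_core b b' m n (act a3 p) a.
Proof.
have [s [_ [[em en] eb]]] := locally_ex
  (locally_and (locally_and (act_local m) (act_local n)) (ract_local b')).
by rewrite -{1}eb as_core_equiv em en.
Qed.
Fact as_core_lunit b b' m n p s :
  act (punit A s) p = p ->
  as_core b b' m n p (lunit p) = as_core b b' m n p (punit A s).
Proof.
move=> sp; rewrite -{1}sp -as_core_mul lunitC as_core_mul.
by rewrite lunit_act.
Qed.

Definition as_in b p b' m n := as_core b b' m n p (lunit p).
Fact as_in_bal b p : @balanced k Gam A B R M N R (bm_id R) _ (as_in b p).
Proof.
split; rewrite /as_in => *.
- by rewrite /as_core sg_D2 !homD.
- exact: as_outD1.
- exact: as_outD2.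
- by rewrite /as_core sg_Z2 !homZ.
- exact: as_outZ1.
- exact: as_outZ2.
- by rewrite -[X in as_core _ _ _ _ _ X]lunit_idem as_core_equiv lunit_act.
Qed.
Definition as_mid b (x : star B M N) p : star B M (star B N P) :=
  star_lift (as_in_bal b p) x.
Fact as_midE b b' m n p :
  as_mid b (sg b' m n) p = as_core b b' m n p (lunit p).
Proof. exact: star_liftE. Qed.
Fact as_midD2 b x y p : as_mid b (x + y) p = as_mid b x p + as_mid b y p.
Proof. exact: star_liftD. Qed.
Fact as_midZ2 b r x p : as_mid b (r *: x) p = r *: as_mid b x p.
Proof. exact: star_liftZ. Qed.
Fact as_mid0 b p : as_mid b 0 p = 0.
Proof. exact: star_lift0. Qed.
Fact as_mid_bal :
  @balanced k Gam A B R (star B M N) P R (bm_id R) _ as_mid.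
Proof.
have I (Q : star B M N -> Prop) :
    Q 0 -> (forall r b m n y, Q y -> Q (r *: (sg b m n : star B M N) + y)) -> forall x, Q x.
  exact: star_ind.
split.
- move=> b b' x p; elim/I: x => [|r c m n y ih]; first by rewrite !as_mid0 addr0.
  rewrite !as_midD2 !as_midZ2 ih !as_midE.
  by rewrite /as_core sg_D1 !homD scalerDr addrACA.
- by move=> *; rewrite as_midD2.
- move=> b x p p'; elim/I: x => [|r c m n y ih]; first by rewrite !as_mid0 addr0.
  rewrite !as_midD2 !as_midZ2 ih !as_midE.
  have [s [_ [ep ep']]] := locally_ex (locally_and (act_local p) (act_local p')).
  rewrite (@as_core_lunit _ _ _ _ _ s ep) (@as_core_lunit _ _ _ _ _ s ep').
  rewrite (@as_core_lunit _ _ _ _ (p + p') s); last by rewrite actDr ep ep'.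
  by rewrite /as_core as_outD3 scalerDr addrACA.
- move=> c b x p; elim/I: x => [|r b' m n y ih]; first by rewrite !as_mid0 scaler0.
  rewrite !as_midD2 !as_midZ2 ih !as_midE /as_core sg_Z1 !homZ scalerDr.
  by rewrite !scalerA mulrC.
- by move=> *; rewrite as_midZ2.
- move=> s b x p; elim/I: x => [|r b' m n y ih]; first by rewrite !as_mid0 scaler0.
  rewrite !as_midD2 !as_midZ2 ih !as_midE scalerDr.
  have [t [_ ep]] := locally_ex (act_local p).
  rewrite (@as_core_lunit _ _ _ _ _ t ep) (@as_core_lunit _ _ _ _ (s *: p) t); last first.
    by rewrite actZr ep.
  by rewrite /as_core as_outZ3 !scalerA mulrC.
- move=> b a a' x p; elim/I: x => [|r b' m n y ih].
    by rewrite as_mid0 act0r as_mid0.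
  rewrite actDr actZr !as_midD2 !as_midZ2 ih; congr (_ *: _ + _).
  have -> : act a (sg b' m n : star B M N) = sg (act a b') m n by exact: star_actE.
  rewrite !as_midE.
  have [t [_ [ep ep']]] := locally_ex (locally_and (act_local p) (act_local (act a' p))).
  rewrite (@as_core_lunit _ _ _ _ _ t ep) (@as_core_lunit _ _ _ _ _ t ep').
  by rewrite -as_core_mul /as_core sg_bal /= -punitC.
Qed.
Definition assoc_fun : star B (star B M N) P -> star B M (star B N P) :=
  star_lift as_mid_bal.
Fact assoc_sg b x p : assoc_fun (sg b x p) = as_mid b x p.
Proof. exact: star_liftE. Qed.
Fact assoc_D x y : assoc_fun (x + y) = assoc_fun x + assoc_fun y.
Proof. exact: star_liftD. Qed.
Fact assoc_Z r x : assoc_fun (r *: x) = r *: assoc_fun x.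
Proof. exact: star_liftZ. Qed.
Fact assoc_A a x : assoc_fun (act a x) = act a (assoc_fun x).
Proof.
have z : assoc_fun 0 = 0 by exact: star_lift0.
have I (Q : star B (star B M N) P -> Prop) :
    Q 0 -> (forall r b m n y, Q y -> Q (r *: (sg b m n : star B (star B M N) P) + y)) ->
    forall x, Q x.
  exact: star_ind.
elim/I: x => [|r b u p y ih]; first by rewrite act0r z act0r.
rewrite actDr actZr !assoc_D !assoc_Z ih actDr actZr; congr (_ *: _ + _).
have -> : act a (sg b u p : star B (star B M N) P) = sg (act a b) u p by exact: star_actE.
rewrite !assoc_sg.
have J (Q : star B M N -> Prop) :
    Q 0 -> (forall r b m n y, Q y -> Q (r *: (sg b m n : star B M N) + y)) -> forall x, Q x.
  exact: star_ind.
elim/J: u => [|s b' m n v iv]; first by rewrite !as_mid0 act0r.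
rewrite !as_midD2 !as_midZ2 iv actDr actZr !as_midE; congr (_ *: _ + _).
by rewrite /as_core -!homA; congr (as_out _ _ _ (ca C _)); rewrite -star_actE.
Qed.
Definition assoc : mhom (star B (star B M N) P) (star B M (star B N P)) :=
  @Hom k Gam A R R (bm_id R) (star B (star B M N) P) (star B M (star B N P))
    assoc_fun assoc_D assoc_Z assoc_A.
End Associator.

Section AssociatorInv.
Variables (R : base_ring k) (M N P : amod A R).

Definition sa_out (m : M) (n : N) (p : P) :
    hom (bm_str R) (star B B (areg A)) (star B (star B M N) P) :=
  star_map B (sghom B m n) (acthom p).
Fact sa_outE m n p b (b' : B) a :
  sa_out m n p (sg b b' (a : areg A)) = sg b (sg b' m n : star B M N) (act a p).
Proof. exact: star_mapE. Qed.
Fact sa_out_ind (Q : star B B (areg A) -> Prop) :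
  Q 0 -> (forall r b (b' : B) (a : areg A) y, Q y -> Q (r *: (sg b b' a : star B B (areg A)) + y)) ->
  forall w, Q w.
Proof. exact: star_ind. Qed.

Fact sa_out_equiv m n p a1 a2 a3 w :
  sa_out m n p (star_map B (bright B (tmk a1 a2)) (aright a3) w) =
  sa_out (act a1 m) (act a2 n) (act a3 p) w.
Proof.
elim/sa_out_ind: w => [|r b b' a y ih]; first by rewrite !hom0.
rewrite !homD !homZ ih; congr (_ *: _ + _).
by rewrite star_mapE !sa_outE /= actM sg_bal.
Qed.
Fact sa_outD1 m m' n p w : sa_out (m + m') n p w = sa_out m n p w + sa_out m' n p w.
Proof.
elim/sa_out_ind: w => [|r b b' a y ih]; first by rewrite !hom0 addr0.
rewrite !homD !homZ ih !sa_outE sg_D2.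
by rewrite (sg_D2 b (sg b' m n : star B M N)) scalerDr addrACA.
Qed.
Fact sa_outD2 m n n' p w : sa_out m (n + n') p w = sa_out m n p w + sa_out m n' p w.
Proof.
elim/sa_out_ind: w => [|r b b' a y ih]; first by rewrite !hom0 addr0.
rewrite !homD !homZ ih !sa_outE sg_D3.
by rewrite (sg_D2 b (sg b' m n : star B M N)) scalerDr addrACA.
Qed.
Fact sa_outD3 m n p p' w : sa_out m n (p + p') w = sa_out m n p w + sa_out m n p' w.
Proof.
elim/sa_out_ind: w => [|r b b' a y ih]; first by rewrite !hom0 addr0.
rewrite !homD !homZ ih !sa_outE actDr.
by rewrite sg_D3 scalerDr addrACA.
Qed.
Fact sa_outZ1 r m n p w : sa_out (r *: m) n p w = r *: sa_out m n p w.
Proof.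
elim/sa_out_ind: w => [|s b b' a y ih]; first by rewrite !hom0 scaler0.
rewrite !homD !homZ ih !sa_outE sg_Z2 (sg_Z2 r b (sg b' m n : star B M N)).
by rewrite scalerDr !scalerA mulrC.
Qed.
Fact sa_outZ2 r m n p w : sa_out m (r *: n) p w = r *: sa_out m n p w.
Proof.
elim/sa_out_ind: w => [|s b b' a y ih]; first by rewrite !hom0 scaler0.
rewrite !homD !homZ ih !sa_outE sg_Z3 (sg_Z2 r b (sg b' m n : star B M N)).
by rewrite scalerDr !scalerA mulrC.
Qed.
Fact sa_outZ3 r m n p w : sa_out m n (r *: p) w = r *: sa_out m n p w.
Proof.
elim/sa_out_ind: w => [|s b b' a y ih]; first by rewrite !hom0 scaler0.
rewrite !homD !homZ ih !sa_outE actZr sg_Z3.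
by rewrite scalerDr !scalerA mulrC.
Qed.

Definition sa_core b b' m n p (a : A) : star B (star B M N) P :=
  sa_out m n p (ca_inv C (sg b (a : areg A) b')).

Fact sa_core_equiv b b' m n p a a1 a2 a3 :
  sa_core b (ract b' (tmk a2 a3)) m n p (la_mul a a1) =
  sa_core b b' (act a1 m) (act a2 n) (act a3 p) a.
Proof.
rewrite /sa_core -sa_out_equiv -ca_inv_equiv.
by rewrite (star_mapE (B := B) (aright a1) (bright B (tmk a2 a3)) b a b').
Qed.
Fact sa_core_mul b b' m n p a a1 :
  sa_core b b' m n p (la_mul a a1) = sa_core b b' (act a1 m) n p a.
Proof.
have [s [_ [[en ep] eb]]] := locally_ex
  (locally_and (locally_and (act_local n) (act_local p)) (ract_local b')).
by rewrite -{1}eb sa_core_equiv en ep.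
Qed.
Fact sa_core_lunit b b' m n p s :
  act (punit A s) m = m ->
  sa_core b b' m n p (lunit m) = sa_core b b' m n p (punit A s).
Proof.
move=> sm; rewrite -{1}sm -sa_core_mul lunitC sa_core_mul.
by rewrite lunit_act.
Qed.

Definition sa_in b m b' n p := sa_core b b' m n p (lunit m).
Fact sa_in_bal b m : @balanced k Gam A B R N P R (bm_id R) _ (sa_in b m).
Proof.
split; rewrite /sa_in => *.
- by rewrite /sa_core sg_D3 !homD.
- exact: sa_outD2.
- exact: sa_outD3.
- by rewrite /sa_core sg_Z3 !homZ.
- exact: sa_outZ2.
- exact: sa_outZ3.
- by rewrite -[X in sa_core _ _ _ _ _ X]lunit_idem sa_core_equiv lunit_act.
Qed.
Definition sa_mid b m (x : star B N P) : star B (star B M N) P :=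
  star_lift (sa_in_bal b m) x.
Fact sa_midE b b' m n p :
  sa_mid b m (sg b' n p) = sa_core b b' m n p (lunit m).
Proof. exact: star_liftE. Qed.
Fact sa_midD3 b x y m : sa_mid b m (x + y) = sa_mid b m x + sa_mid b m y.
Proof. exact: star_liftD. Qed.
Fact sa_midZ3 b r x m : sa_mid b m (r *: x) = r *: sa_mid b m x.
Proof. exact: star_liftZ. Qed.
Fact sa_mid0 b m : sa_mid b m 0 = 0.
Proof. exact: star_lift0. Qed.
Fact sa_mid_bal :
  @balanced k Gam A B R M (star B N P) R (bm_id R) _ sa_mid.
Proof.
have I (Q : star B N P -> Prop) :
    Q 0 -> (forall r b m n y, Q y -> Q (r *: (sg b m n : star B N P) + y)) -> forall x, Q x.
  exact: star_ind.
split.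
- move=> b b' m x; elim/I: x => [|r c n p y ih]; first by rewrite !sa_mid0 addr0.
  rewrite !sa_midD3 !sa_midZ3 ih !sa_midE.
  by rewrite /sa_core sg_D1 !homD scalerDr addrACA.
- move=> b m m' x; elim/I: x => [|r c n p y ih]; first by rewrite !sa_mid0 addr0.
  rewrite !sa_midD3 !sa_midZ3 ih !sa_midE.
  have [s [_ [em em']]] := locally_ex (locally_and (act_local m) (act_local m')).
  rewrite (@sa_core_lunit _ _ _ _ _ s em) (@sa_core_lunit _ _ _ _ _ s em').
  rewrite (@sa_core_lunit _ _ (m + m') _ _ s); last by rewrite actDr em em'.
  by rewrite /sa_core sa_outD1 scalerDr addrACA.
- by move=> *; rewrite sa_midD3.
- move=> c b m x; elim/I: x => [|r b' n p y ih]; first by rewrite !sa_mid0 scaler0.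
  rewrite !sa_midD3 !sa_midZ3 ih !sa_midE /sa_core sg_Z1 !homZ scalerDr.
  by rewrite !scalerA mulrC.
- move=> s b m x; elim/I: x => [|r b' n p y ih]; first by rewrite !sa_mid0 scaler0.
  rewrite !sa_midD3 !sa_midZ3 ih !sa_midE scalerDr.
  have [t [_ em]] := locally_ex (act_local m).
  rewrite (@sa_core_lunit _ _ _ _ _ t em) (@sa_core_lunit _ _ (s *: m) _ _ t); last first.
    by rewrite actZr em.
  by rewrite /sa_core sa_outZ1 !scalerA mulrC.
- by move=> *; rewrite sa_midZ3.
- move=> b a a' m x; elim/I: x => [|r b' n p y ih].
    by rewrite sa_mid0 act0r sa_mid0.
  rewrite actDr actZr !sa_midD3 !sa_midZ3 ih; congr (_ *: _ + _).
  have -> : act a' (sg b' n p : star B N P) = sg (act a' b') n p by exact: star_actE.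
  rewrite !sa_midE.
  have [t [_ [em em']]] := locally_ex (locally_and (act_local m) (act_local (act a m))).
  rewrite (@sa_core_lunit _ _ _ _ _ t em) (@sa_core_lunit _ _ _ _ _ t em').
  by rewrite -sa_core_mul /sa_core sg_bal /= -punitC.
Qed.
Definition assocV_fun : star B M (star B N P) -> star B (star B M N) P :=
  star_lift sa_mid_bal.
Fact assocV_sg b m x : assocV_fun (sg b m x) = sa_mid b m x.
Proof. exact: star_liftE. Qed.
Fact assocV_D x y : assocV_fun (x + y) = assocV_fun x + assocV_fun y.
Proof. exact: star_liftD. Qed.
Fact assocV_Z r x : assocV_fun (r *: x) = r *: assocV_fun x.
Proof. exact: star_liftZ. Qed.
Fact assocV_A a x : assocV_fun (act a x) = act a (assocV_fun x).
Proof.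
have z : assocV_fun 0 = 0 by exact: star_lift0.
have I (Q : star B M (star B N P) -> Prop) :
    Q 0 -> (forall r b m n y, Q y -> Q (r *: (sg b m n : star B M (star B N P)) + y)) ->
    forall x, Q x.
  exact: star_ind.
elim/I: x => [|r b m u y ih]; first by rewrite act0r z act0r.
rewrite actDr actZr !assocV_D !assocV_Z ih actDr actZr; congr (_ *: _ + _).
have -> : act a (sg b m u : star B M (star B N P)) = sg (act a b) m u by exact: star_actE.
rewrite !assocV_sg.
have J (Q : star B N P -> Prop) :
    Q 0 -> (forall r b m n y, Q y -> Q (r *: (sg b m n : star B N P) + y)) -> forall x, Q x.
  exact: star_ind.
elim/J: u => [|s b' n p v iv]; first by rewrite !sa_mid0 act0r.
rewrite !sa_midD3 !sa_midZ3 iv actDr actZr !sa_midE; congr (_ *: _ + _).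
by rewrite /sa_core -!homA; congr (sa_out _ _ _ (ca_inv C _)); rewrite -star_actE.
Qed.
Definition assocV : mhom (star B M (star B N P)) (star B (star B M N) P) :=
  @Hom k Gam A R R (bm_id R) (star B M (star B N P)) (star B (star B M N) P)
    assocV_fun assocV_D assocV_Z assocV_A.
End AssociatorInv.

Section Unitors.
Variable M : amod A (Bk k).
Local Notation I := (aunit eps (Bk k)).

Definition ru_core b (m : M) (c : I) (a : A) : M := act (cr C (sg b (a : areg A) c)) m.
Fact ru_core_mul b m c a a1 : ru_core b m c (la_mul a a1) = ru_core b (act a1 m) c a.
Proof.
rewrite /ru_core -actM; congr act.
rewrite -[la_mul (cr C _) a1]/(aright a1 (cr C _)) -cr_equiv.
by rewrite (star_mapE (B := B) (aright a1) (hid I)).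
Qed.
Fact ru_core_lunit b m c s : act (punit A s) m = m ->
  ru_core b m c (lunit m) = ru_core b m c (punit A s).
Proof. by move=> sm; rewrite -{1}sm -ru_core_mul lunitC ru_core_mul lunit_act. Qed.
Definition ru_in b (m : M) (c : I) : M := ru_core b m c (lunit m).
Fact ru_bal : @balanced k Gam A B (Bk k) M I (Bk k) (bm_id _) M ru_in.
Proof.
split; rewrite /ru_in.
- by move=> *; rewrite /ru_core sg_D1 homD actDl.
- move=> b m m' c.
  have [s [_ [em em']]] := locally_ex (locally_and (act_local m) (act_local m')).
  rewrite (@ru_core_lunit _ _ _ s em) (@ru_core_lunit _ _ _ s em').
  rewrite (@ru_core_lunit _ (m + m') _ s); last by rewrite actDr em em'.
  exact: actDr.
- by move=> *; rewrite /ru_core sg_D3 homD actDl.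
- by move=> *; rewrite /ru_core sg_Z1 homZ actZl.
- move=> r b m c.
  have [s [_ em]] := locally_ex (act_local m).
  rewrite (@ru_core_lunit _ _ _ s em) (@ru_core_lunit _ (r *: m) _ s); last by rewrite actZr em.
  exact: actZr.
- by move=> r b m c; rewrite /ru_core sg_Z3 homZ (actZl r).
- move=> b a a' m c.
  have [s [_ [em em']]] := locally_ex (locally_and (act_local m) (act_local (act a m))).
  rewrite (@ru_core_lunit _ _ _ s em) (@ru_core_lunit _ _ _ s em').
  by rewrite -ru_core_mul /ru_core sg_bal /= -punitC.
Qed.
Definition runitor_fun : star B M I -> M := star_lift ru_bal.
Fact runitor_D x y : runitor_fun (x + y) = runitor_fun x + runitor_fun y.
Proof. exact: star_liftD. Qed.
Fact runitor_Z r x : runitor_fun (r *: x) = r *: runitor_fun x.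
Proof. exact: star_liftZ. Qed.
Fact runitor_A a x : runitor_fun (act a x) = act a (runitor_fun x).
Proof.
have z : runitor_fun 0 = 0 by exact: star_lift0.
have Ind (Q : star B M I -> Prop) :
    Q 0 -> (forall r b m n y, Q y -> Q (r *: (sg b m n : star B M I) + y)) -> forall x, Q x.
  exact: star_ind.
elim/Ind: x => [|r b m c y ih]; first by rewrite act0r z act0r.
rewrite actDr actZr !runitor_D !runitor_Z ih actDr actZr; congr (_ *: _ + _).
have -> : act a (sg b m c : star B M I) = sg (act a b) m c by exact: star_actE.
rewrite /runitor_fun !star_liftE /ru_in /ru_core -actM.
by rewrite -[la_mul a _]/(act a (cr C _)) -homA; congr (act (cr C _) _); rewrite -star_actE.
Qed.
Definition runitor : mhom (star B M I) M :=
  @Hom k Gam A _ _ (bm_id (Bk k)) (star B M I) M runitor_fun runitor_D runitor_Z runitor_A.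

Definition lu_core b (c : I) (m : M) (a : A) : M := act (cl C (sg b c (a : areg A))) m.
Fact lu_core_mul b c m a a1 : lu_core b c m (la_mul a a1) = lu_core b c (act a1 m) a.
Proof.
rewrite /lu_core -actM; congr act.
rewrite -[la_mul (cl C _) a1]/(aright a1 (cl C _)) -cl_equiv.
by rewrite (star_mapE (B := B) (hid I) (aright a1)).
Qed.
Fact lu_core_lunit b c m s : act (punit A s) m = m ->
  lu_core b c m (lunit m) = lu_core b c m (punit A s).
Proof. by move=> sm; rewrite -{1}sm -lu_core_mul lunitC lu_core_mul lunit_act. Qed.
Definition lu_in b (c : I) (m : M) : M := lu_core b c m (lunit m).
Fact lu_bal : @balanced k Gam A B (Bk k) I M (Bk k) (bm_id _) M lu_in.
Proof.
split; rewrite /lu_in.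
- by move=> *; rewrite /lu_core sg_D1 homD actDl.
- by move=> *; rewrite /lu_core sg_D2 homD actDl.
- move=> b c m m'.
  have [s [_ [em em']]] := locally_ex (locally_and (act_local m) (act_local m')).
  rewrite (@lu_core_lunit _ _ _ s em) (@lu_core_lunit _ _ _ s em').
  rewrite (@lu_core_lunit _ _ (m + m') s); last by rewrite actDr em em'.
  exact: actDr.
- by move=> *; rewrite /lu_core sg_Z1 homZ actZl.
- by move=> r b c m; rewrite /lu_core sg_Z2 homZ (actZl r).
- move=> r b c m.
  have [s [_ em]] := locally_ex (act_local m).
  rewrite (@lu_core_lunit _ _ _ s em) (@lu_core_lunit _ _ (r *: m) s); last by rewrite actZr em.
  exact: actZr.
- move=> b a a' c m.
  have [s [_ [em em']]] := locally_ex (locally_and (act_local m) (act_local (act a' m))).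
  rewrite (@lu_core_lunit _ _ _ s em) (@lu_core_lunit _ _ _ s em').
  by rewrite -lu_core_mul /lu_core sg_bal /= -punitC.
Qed.
Definition lunitor_fun : star B I M -> M := star_lift lu_bal.
Fact lunitor_D x y : lunitor_fun (x + y) = lunitor_fun x + lunitor_fun y.
Proof. exact: star_liftD. Qed.
Fact lunitor_Z r x : lunitor_fun (r *: x) = r *: lunitor_fun x.
Proof. exact: star_liftZ. Qed.
Fact lunitor_A a x : lunitor_fun (act a x) = act a (lunitor_fun x).
Proof.
have z : lunitor_fun 0 = 0 by exact: star_lift0.
have Ind (Q : star B I M -> Prop) :
    Q 0 -> (forall r b m n y, Q y -> Q (r *: (sg b m n : star B I M) + y)) -> forall x, Q x.
  exact: star_ind.
elim/Ind: x => [|r b c m y ih]; first by rewrite act0r z act0r.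
rewrite actDr actZr !lunitor_D !lunitor_Z ih actDr actZr; congr (_ *: _ + _).
have -> : act a (sg b c m : star B I M) = sg (act a b) c m by exact: star_actE.
rewrite /lunitor_fun !star_liftE /lu_in /lu_core -actM.
by rewrite -[la_mul a _]/(act a (cl C _)) -homA; congr (act (cl C _) _); rewrite -star_actE.
Qed.
Definition lunitor : mhom (star B I M) M :=
  @Hom k Gam A _ _ (bm_id (Bk k)) (star B I M) M lunitor_fun lunitor_D lunitor_Z lunitor_A.
End Unitors.

Record coherent : Prop := Coherent {
  pentagon : forall (M N P Q : amod A (Bk k)) x,
    assoc M N (star B P Q) (assoc (star B M N) P Q x) =
    star_map B (hid M) (assoc N P Q)
      (assoc M (star B N P) Q (star_map B (assoc M N P) (hid Q) x));
  triangle : forall (M N : amod A (Bk k)) x,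
    star_map B (hid M) (lunitor N) (assoc M (aunit eps (Bk k)) N x) =
    star_map B (runitor M) (hid N) x }.

End Constraints.

Section Submodules.
Variables (k : fieldType) (Gam : nmodType) (A : lu_algebra k Gam).
Variable R : base_ring k.
Implicit Types M : amod A R.

Record submod M := Submod {
  in_sub :> M -> Prop;
  sub_0 : in_sub 0;
  sub_D : forall x y, in_sub x -> in_sub y -> in_sub (x + y);
  sub_Z : forall r x, in_sub x -> in_sub (r *: x);
  sub_A : forall a x, in_sub x -> in_sub (act a x) }.

Section Sub.
Variables (M : amod A R) (N : submod M).
Definition sub_pred : M -> bool := fun x => `[< N x >].
Fact sub_pred_closed : submod_closed sub_pred.
Proof.
split=> [|r x y]; first by apply/asboolP; apply: sub_0.
rewrite /in_mem /= => /asboolP Nx /asboolP Ny; apply/asboolP.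
by apply: sub_D => //; apply: sub_Z.
Qed.
HB.instance Definition _ := GRing.isSubmodClosed.Build R M sub_pred sub_pred_closed.
Definition sub_type : Type := {x : M | sub_pred x}.
HB.instance Definition _ := SubChoice.on sub_type.
HB.instance Definition _ := [SubChoice_isSubLmodule of sub_type by <:].

Fact sub_act_in a (x : sub_type) : sub_pred (act a (val x)).
Proof. by apply/asboolP/sub_A/asboolP; exact: (valP x). Qed.
Definition sub_act a (x : sub_type) : sub_type := Sub (act a (val x)) (sub_act_in a x).
Fact sub_act_Dl a b x : sub_act (a + b) x = sub_act a x + sub_act b x.
Proof. by apply: val_inj; rewrite /= actDl. Qed.
Fact sub_act_Zl c a x : sub_act (c *: a) x = br_in R c *: sub_act a x.
Proof. by apply: val_inj; rewrite /= actZl. Qed.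
Fact sub_act_Dr a x y : sub_act a (x + y) = sub_act a x + sub_act a y.
Proof. by apply: val_inj; rewrite /= actDr. Qed.
Fact sub_act_Zr a r x : sub_act a (r *: x) = r *: sub_act a x.
Proof. by apply: val_inj; rewrite /= actZr. Qed.
Fact sub_act_M a b x : sub_act (la_mul a b) x = sub_act a (sub_act b x).
Proof. by apply: val_inj; rewrite /= actM. Qed.
Fact sub_act_dec x : exists s : seq Gam,
  uniq s /\ x = \sum_(g <- s) sub_act (la_one A g) x.
Proof.
apply: dec_of_local; first by move=> a b m; apply: sub_act_Dl.
by apply: locally_mono (act_local (val x)) => e ex; apply: val_inj.
Qed.
Definition sub_amod : amod A R :=
  @AMod k Gam A R sub_type sub_act sub_act_Dl sub_act_Zl sub_act_Dr sub_act_Zr sub_act_M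
    sub_act_dec.
Definition sub_incl : mhom sub_amod M :=
  @Hom k Gam A R R (bm_id R) sub_amod M val (fun _ _ => erefl) (fun _ _ => erefl)
    (fun _ _ => erefl).
End Sub.

Section Quo.
Variables (M : amod A R) (N : submod M).
Local Notation Q := (lquot (N : M -> Prop)).
Local Notation pr := (lproj (N : M -> Prop)).
Fact span_sub x : span N x <-> N x.
Proof.
split=> [|Nx]; last exact: span_gen.
by elim=> [|r u v Nu _ Nv]; [apply: sub_0 | apply: sub_D => //; apply: sub_Z].
Qed.
Definition quo_act a (q : Q) : Q := pr (act a (lrepr q)).
Fact quo_actE a x : quo_act a (pr x) = pr (act a x).
Proof.
apply/lprojP/span_sub.
have -> : act a (lrepr (pr x)) - act a x = act a (lrepr (pr x) - x).
  by rewrite actDr -scaleN1r -actZr scaleN1r.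
by apply/sub_A/span_sub/lprojP; rewrite lprojK.
Qed.
Fact quo_act_Dl a b x : quo_act (a + b) x = quo_act a x + quo_act b x.
Proof. by rewrite -[x]lprojK !quo_actE actDl lprojD. Qed.
Fact quo_act_Zl c a x : quo_act (c *: a) x = br_in R c *: quo_act a x.
Proof. by rewrite -[x]lprojK !quo_actE actZl lprojZ. Qed.
Fact quo_act_Dr a x y : quo_act a (x + y) = quo_act a x + quo_act a y.
Proof. by rewrite -[x]lprojK -[y]lprojK -lprojD !quo_actE actDr lprojD. Qed.
Fact quo_act_Zr a r x : quo_act a (r *: x) = r *: quo_act a x.
Proof. by rewrite -[x]lprojK -lprojZ !quo_actE actZr lprojZ. Qed.
Fact quo_act_M a b x : quo_act (la_mul a b) x = quo_act a (quo_act b x).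
Proof. by rewrite -[x]lprojK !quo_actE actM. Qed.
Fact quo_act_dec x : exists s : seq Gam,
  uniq s /\ x = \sum_(g <- s) quo_act (la_one A g) x.
Proof.
apply: dec_of_local; first by move=> a b m; apply: quo_act_Dl.
rewrite -[x]lprojK; apply: locally_mono (act_local (lrepr x)) => e ex.
by rewrite quo_actE ex.
Qed.
Definition quo_amod : amod A R :=
  @AMod k Gam A R Q quo_act quo_act_Dl quo_act_Zl quo_act_Dr quo_act_Zr quo_act_M
    quo_act_dec.
Definition quo_proj : mhom M quo_amod :=
  @Hom k Gam A R R (bm_id R) M quo_amod pr (@lprojD _ _ _) (@lprojZ _ _ _)
    (fun a x => esym (quo_actE a x)).
End Quo.

Section SubIn.
Variables (M : amod A R) (N' N : submod M).
Definition sub_in : submod (sub_amod N') :=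
  @Submod (sub_amod N') (fun x => N (sub_incl N' x))
    (sub_0 N) (fun _ _ => @sub_D _ N _ _) (fun r _ => @sub_Z _ N r _)
    (fun a _ => @sub_A _ N a _).
End SubIn.

Definition isomorphic (M N : amod A R) := exists f : mhom M N, is_iso f.

Definition simple (M : amod A R) :=
  (exists x : M, x <> 0) /\
  forall N : submod M, (forall x, N x -> x = 0) \/ (forall x, N x).

Definition maximal (M : amod A R) (N : submod M) :=
  (exists x, ~ N x) /\
  forall N' : submod M, (forall x, N x -> N' x) ->
    (forall x, N' x -> N x) \/ (forall x, N' x).

Definition is_head (M H : amod A R) := exists f : mhom M H,
  surjective_hom f /\
  forall x, f x = 0 <-> forall N : submod M, maximal N -> N x.

Definition exact_seq (X Y Z : amod A R) (f : mhom X Y) (g : mhom Y Z) :=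
  [/\ injective_hom f, surjective_hom g
    & forall y, g y = 0 <-> exists x, y = f x].

Definition finitely_generated (M : amod A R) := exists n (e : 'I_n -> M),
  forall x, exists c : 'I_n -> R, x = \sum_i c i *: e i.

Definition free_of_finite_rank (M : amod A R) := exists n (e : 'I_n -> M),
  forall x, exists! c : {ffun 'I_n -> R}, x = \sum_i c i *: e i.

End Submodules.

Section Categories.
Variables (k : fieldType) (Gam : nmodType) (A : lu_algebra k Gam).
Variables (eps : augmentation A) (B : star_bimod A).
Local Notation kmod := (amod A (Bk k)).

Record serre_subcat := SerreSubcat {
  sc_in :> kmod -> Prop;
  sc_fd : forall X, sc_in X -> finitely_generated X;
  sc_serre : forall (X Y Z : kmod) (f : mhom X Y) (g : mhom Y Z),
    exact_seq f g -> finitely_generated Y -> (sc_in Y <-> sc_in X /\ sc_in Z);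
  sc_unit : sc_in (aunit eps (Bk k));
  sc_star : forall X Y, sc_in X -> sc_in Y -> sc_in (star B X Y) }.

Variable C : serre_subcat.

Record obj := Obj { obj_mod :> kmod; obj_in : C obj_mod }.

Fact sub_exact (M : kmod) (N : submod M) : exact_seq (sub_incl N) (quo_proj N).
Proof.
split; first exact: val_inj.
  by move=> y; exists (lrepr y); exact: lprojK.
move=> y; split.
  move=> E; have /lprojP /span_sub Ny : quo_proj N y = lproj N 0 by rewrite lproj0.
  by move: Ny; rewrite subr0 => /asboolP Ny; exists (Sub y Ny : sub_type N).
case=> x ->; rewrite -[RHS](lproj0 N); apply/lprojP/span_sub; rewrite subr0.
by apply/asboolP; exact: (valP x).
Qed.
Fact sub_in_C (X : obj) (N : submod X) : C (sub_amod N).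
Proof. by have /(_ (sc_fd (obj_in X))) [/(_ (obj_in X)) []] := sc_serre C (sub_exact N). Qed.
Fact quo_in_C (X : obj) (N : submod X) : C (quo_amod N).
Proof. by have /(_ (sc_fd (obj_in X))) [/(_ (obj_in X)) []] := sc_serre C (sub_exact N). Qed.
Definition sub_obj (X : obj) (N : submod X) : obj := Obj (sub_in_C N).
Definition quo_obj (X : obj) (N : submod X) : obj := Obj (quo_in_C N).

(* K(C) is the free abelian group on the objects of C (as functions obj -> int with
   finite support) modulo the relations given by short exact sequences. Since obj is
   too large to be the carrier of a library structure, K(C) is handled as a setoid:
   [Keq f g] is the equality of the classes of f and g. *)
Definition cls (X : obj) : obj -> int := fun Y => if `[< Y = X >] then 1 else 0.

Inductive Krel : (obj -> int) -> Prop :=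
| Krel_0 : Krel (fun _ => 0)
| Krel_exact (c : int) (X Y Z : obj) (f : mhom X Y) (g : mhom Y Z) h :
    exact_seq f g -> Krel h ->
    Krel (fun W => c * (cls Y W - cls X W - cls Z W) + h W).

Definition Keq (f g : obj -> int) : Prop := Krel (fun W => f W - g W).

End Categories.

Definition idx (J : pred int) : Type := {j : int | J j}.
HB.instance Definition _ (J : pred int) := Choice.on (idx J).
Definition idx_val (J : pred int) (j : idx J) : int := val j.

Definition tuples (J : pred int) := {fsfun idx J -> nat with 0%N}.

Definition in_shape (J : pred int) (d : tuples J) (e : seq (idx J)) :=
  forall j, count_mem j e = d j.
Definition seq_s (J : pred int) (d : tuples J) : seq (idx J) :=
  sort (fun i j => idx_val j <= idx_val i)
    (flatten [seq nseq (d j) j | j <- enum_fset (finsupp d)]).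
Definition seq_c (J : pred int) (d : tuples J) : seq (idx J) := rev (seq_s d).

Section PBW.
Variables (k : fieldType) (Gam : nmodType) (A : lu_algebra k Gam).
Variables (eps : augmentation A) (B : star_bimod A).
Variables (C : serre_subcat eps B) (J : pred int).

Definition star_seq R (L : idx J -> amod A R) (e : seq (idx J)) : amod A R :=
  foldr (fun j X => star B (L j) X) (aunit eps R) e.

Fact star_seq_in (L : idx J -> amod A (Bk k)) e : (forall j, C (L j)) -> C (star_seq L e).
Proof.
by move=> CL; elim: e => [|j e ih] /=; [exact: sc_unit | exact: sc_star].
Qed.
Definition star_seq_obj (L : idx J -> obj C) (e : seq (idx J)) : obj C :=
  Obj (star_seq_in e (fun j => obj_in (L j))).

Record pbw_theory := PBW {
  pbw_L : idx J -> obj C;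
  pbw_L_simple : forall j, simple (pbw_L j);
  pbw_le : tuples J -> tuples J -> Prop;
  pbw_le_refl : forall d, pbw_le d d;
  pbw_le_anti : forall d d', pbw_le d d' -> pbw_le d' d -> d = d';
  pbw_le_trans : forall d d' d'', pbw_le d d' -> pbw_le d' d'' -> pbw_le d d'';
  pbw_head : tuples J -> obj C;
  pbw_headP : forall d, is_head (star_seq_obj pbw_L (seq_s d)) (pbw_head d);
  pbw_head_simple : forall d, simple (pbw_head d);
  pbw_complete : forall X : obj C, simple X -> exists d, isomorphic X (pbw_head d);
  pbw_irredundant : forall d d', isomorphic (pbw_head d) (pbw_head d') -> d = d';
  pbw_triangular : forall d, exists (s : seq (tuples J)) (P : tuples J -> int),
    [/\ uniq s, forall d', d' \in s -> pbw_le d' d /\ d' <> d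
      & Keq (cls (star_seq_obj pbw_L (seq_s d)))
          (fun W => cls (pbw_head d) W + \sum_(d' <- s) P d' * cls (pbw_head d') W)] }.

Variable L : idx J -> obj C.

Definition starK (M N : amod A (BO k)) : amod A (BK k) := bc (bm_OK k) (star B M N).

Record gc_deformation := GCDeformation {
  gc_L : idx J -> amod A (BO k);
  gc_free : forall j, free_of_finite_rank (gc_L j);
  gc_spec : forall j, mhom (bc (bm_ev0 k) (gc_L j)) (L j);
  gc_spec_iso : forall j, is_iso (gc_spec j);
  gc_comm : forall i j, isomorphic (starK (gc_L i) (gc_L j)) (starK (gc_L j) (gc_L i));
  gc_end : forall i j (f : mhom (starK (gc_L i) (gc_L j)) (starK (gc_L i) (gc_L j))),
    exists c : BK k, forall x, f x = c *: x }.

Variable D : gc_deformation.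
Local Notation Lt := (gc_L D).
Local Notation MO := (star_seq Lt).
Local Notation Mk := (star_seq_obj L).
Local Notation inK M := (bc_in (bm_OK k) M).

Definition zpow (n : int) : BK k := ((tofrac (ps_z k : pseries k) : {fraction pseries k}) ^ n).
Definition is_unitO (u : BO k) : Prop := (u : pseries k) \is a GRing.unit.

(* Renormalized R-matrices; [rm_lat i j] is the restriction of R_{i,j} to the
   O-lattices. *)
Record r_matrices := RMatrices {
  rm_R : forall i j, mhom (starK (Lt i) (Lt j)) (starK (Lt j) (Lt i));
  rm_iso : forall i j, is_iso (rm_R i j);
  rm_lat : forall i j, mhom (star B (Lt i) (Lt j)) (star B (Lt j) (Lt i));
  rm_latP : forall i j x, rm_R i j (inK _ x) = inK _ (rm_lat i j x);
  rm_norm : forall i j, ~ (forall x, exists y,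
    rm_R i j (inK _ x) = inK (star B (Lt j) (Lt i)) ((ps_z k : BO k) *: y)) }.

Variable Rm : r_matrices.

Definition is_alpha (al : idx J -> idx J -> nat) := forall i j, exists u : BO k,
  is_unitO u /\
  forall x, rm_R Rm i j (rm_R Rm j i x) = (bm_OK k u * zpow (al i j)%:Z) *: x.

Variable Co : constraints eps B.

(* The maps id * R_{i,j} * id on products over K are the extensions to K of the
   O-linear maps obtained from the restriction of R_{i,j} to the lattices; this avoids
   identifying (M *_O N)_K with M_K *_K N_K. *)
Fixpoint rm_step (s : seq (idx J)) (i j : idx J) (t : seq (idx J)) :
    mhom (MO (s ++ [:: i, j & t])) (MO (s ++ [:: j, i & t])) :=
  match s with
  | [::] => hcomp (assoc Co (Lt j) (Lt i) (MO t))
              (hcomp (star_map B (rm_lat Rm i j) (hid (MO t)))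
                (assocV Co (Lt i) (Lt j) (MO t)))
  | a :: s' => star_map B (hid (Lt a)) (rm_step s' i j t)
  end.
Definition rm_stepK s i j t := bc_map (bm_OK k) (rm_step s i j t).

Definition consistent := forall i j l : idx J,
  idx_val i < idx_val j -> idx_val j < idx_val l ->
  exists u : BO k, is_unitO u /\ forall x : bc (bm_OK k) (MO [:: i; j; l]),
    rm_stepK [::] j l [:: i] (rm_stepK [:: j] i l [::] (rm_stepK [::] i j [:: l] x)) =
    bm_OK k u *:
    rm_stepK [:: l] i j [::] (rm_stepK [::] i l [:: j] (rm_stepK [:: i] j l [::] x)).

Variable al : idx J -> idx J -> nat.

Definition move_ok (i j : idx J) : Prop :=
  al i j = 0%N \/ (0 < al i j)%N /\ idx_val j < idx_val i.

Inductive moves : seq (idx J) -> seq (idx J) -> Type :=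
| moves_nil e : moves e e
| moves_cons s i j t e :
    move_ok i j -> moves (s ++ [:: j, i & t]) e -> moves (s ++ [:: i, j & t]) e.

(* R_{e',e}, as the composition along a sequence of moves from e to e' *)
Fixpoint rm_moves e e' (p : moves e e') :
    mhom (bc (bm_OK k) (MO e)) (bc (bm_OK k) (MO e')) :=
  match p with
  | moves_nil e => hid (bc (bm_OK k) (MO e))
  | moves_cons s i j t e _ p' => hcomp (rm_moves p') (rm_stepK s i j t)
  end.

Definition spec1 (j : idx J) : hom (bm_ev0 k) (Lt j) (L j) :=
  hcomp (gc_spec D j) (bc_in (bm_ev0 k) (Lt j)).
Fixpoint ev0 (e : seq (idx J)) : hom (bm_ev0 k) (MO e) (star_seq L e) :=
  match e with
  | [::] => unit_map eps (bm_ev0 k)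
  | j :: e' => star_map B (spec1 j) (ev0 e')
  end.

Section Filtration.
Variables (es e ec : seq (idx J)) (p : moves es e) (q : moves e ec).

(* y lies in z^a R_{e,es} M(es) and in z^(n-a) R_{ec,e}^-1 M(ec) *)
Definition in_level (n a : int) (y : bc (bm_OK k) (MO e)) : Prop :=
  (exists u : MO es, y = zpow a *: rm_moves p (inK _ u)) /\
  (exists v : MO ec, rm_moves q y = zpow (n - a) *: inK _ v).

Definition jantzen_pred (n : int) (x : Mk e) : Prop :=
  exists m : MO e, ev0 e m = x /\
  exists w : seq (int * bc (bm_OK k) (MO e)),
    (forall b, b \in w -> in_level n b.1 b.2) /\ inK _ m = \sum_(b <- w) b.2.

Fact scaleCA (R : base_ring k) (M : amod A R) (c d : R) (x : M) :
  c *: (d *: x) = d *: (c *: x).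
Proof. by rewrite !scalerA mulrC. Qed.
Fact in_level_Z n a (r : BO k) y : in_level n a y -> in_level n a (bm_OK k r *: y).
Proof.
case=> -[u hu] [v hv]; split.
  exists (r *: u); rewrite hu (homZ (inK _)) (homZ (rm_moves p)); exact: scaleCA.
exists (r *: v); rewrite (homZ (rm_moves q)) hv (homZ (inK _)); exact: scaleCA.
Qed.
Fact in_level_A n a (c : A) y : in_level n a y -> in_level n a (act c y).
Proof.
case=> -[u hu] [v hv]; split.
  by exists (act c u); rewrite hu !homA actZr.
by exists (act c v); rewrite !homA hv actZr.
Qed.
Fact jantzen_0 n : jantzen_pred n 0.
Proof.
exists 0; split; first exact: hom0.
by exists [::]; rewrite big_nil hom0.
Qed.
Fact jantzen_D n x y : jantzen_pred n x -> jantzen_pred n y -> jantzen_pred n (x + y).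
Proof.
case=> m [<- [w [hw ew]]] [m' [<- [w' [hw' ew']]]].
exists (m + m'); split; first exact: homD.
exists (w ++ w'); rewrite homD ew ew' big_cat; split=> // b.
by rewrite mem_cat => /orP[/hw|/hw'].
Qed.
Fact jantzen_Z n (r : Bk k) x : jantzen_pred n x -> jantzen_pred n (r *: x).
Proof.
case=> m [<- [w [hw ew]]]; exists ((ps_const r : BO k) *: m); split; first by rewrite homZ.
exists [seq (b.1, bm_OK k (ps_const r) *: b.2) | b <- w]; split.
  by move=> _ /mapP[b bw ->]; apply/in_level_Z/hw.
by rewrite big_map homZ ew scaler_sumr.
Qed.
Fact jantzen_A n (a : A) x : jantzen_pred n x -> jantzen_pred n (act a x).
Proof.
case=> m [<- [w [hw ew]]]; exists (act a m); split; first by rewrite homA.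
exists [seq (b.1, act a b.2) | b <- w]; split.
  by move=> _ /mapP[b bw ->]; apply/in_level_A/hw.
rewrite big_map homA ew; elim: w {hw ew} => [|b w ih]; first by rewrite !big_nil act0r.
by rewrite !big_cons actDr ih.
Qed.
Definition jantzen (n : int) : submod (Mk e) :=
  @Submod k Gam A (Bk k) (Mk e) (jantzen_pred n)
    (@jantzen_0 n) (@jantzen_D n) (@jantzen_Z n) (@jantzen_A n).

(* [M(e)]_t is given by its coefficients: n |-> [F_n / F_(n+1)]. *)
Definition tclass (n : int) : obj C -> int :=
  cls (@quo_obj _ _ _ _ _ C (@sub_obj _ _ _ _ _ C (Mk e) (jantzen n))
        (sub_in (jantzen n) (jantzen (n + 1)))).

End Filtration.
End PBW.

Section LaurentDegrees.
Variables (k : fieldType) (Gam : nmodType) (A : lu_algebra k Gam).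
Variables (eps : augmentation A) (B : star_bimod A) (C : serre_subcat eps B).
Variable P : int -> obj C -> int.

Definition occurs (n : int) := ~ Keq (P n) (fun _ => 0).
Definition highest_power (n : int) := occurs n /\ forall m, occurs m -> m <= n.
Definition lowest_power (n : int) := occurs n /\ forall m, occurs m -> n <= m.
End LaurentDegrees.

(* Main.v *)
Require Import Defs.
From HB Require Import structures.
From mathcomp Require Import all_boot all_order all_algebra.
From mathcomp Require Import finmap boolp freeg.

(** Write [M~(e)] for the O-lattice of a mixed product.  It is torsion-free, because [B] is
    locally free as a right module, and [M(e) = M~(e)/z].  Up to units and powers of [z] the
    R-matrices are isomorphisms of lattices, so [F_n] is all of [M] for small [n] and zero
    for large [n], and [M] is nonzero because [M(e_s)] has a simple head.  The highest power
    of [t] is then the last [n] with [F_n <> 0], whose coefficient is the class of the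
    submodule [F_n]; the lowest power is the last [n] with [F_n = M], whose coefficient is
    the class of the quotient [M/F_(n+1)].  Dimension is additive on K(C), hence a nonzero
    graded piece has a nonzero class. *)

Set Implicit Arguments.
Unset Strict Implicit.
Unset Printing Implicit Defensive.
Import Defs.
Import Order.TTheory GRing.Theory Num.Theory.
Local Open Scope ring_scope.

(** * Associativity *)

Section AssociatorInverse.
Variables (k : fieldType) (Gam : nmodType) (A : lu_algebra k Gam).
Variables (eps : augmentation A) (B : star_bimod A) (C : constraints eps B).
Variables (R : base_ring k) (M N P : amod A R).

Lemma star_amod_ind (X Y : amod A R) (Q : star B X Y -> Prop) :
  Q 0 -> (forall r b m n y, Q y -> Q (r *: (sg b m n : star B X Y) + y)) -> forall x, Q x.
Proof. exact: star_ind. Qed.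

Lemma assocV_as_out (m : M) (n : N) (p : P) w :
  assocV C M N P (as_out B m n p w) = sa_out B m n p (ca_inv C w).
Proof.
elim/as_out_ind: w => [|r b a b' y ih]; first by rewrite !hom0.
rewrite !homD !homZ ih as_outE; congr (_ *: _ + _).
rewrite /= assocV_sg sa_midE.
have [s [_ [em ea]]] := locally_ex
  (locally_and (act_local (act a m)) (act_local (a : areg A))).
rewrite (@sa_core_lunit _ _ _ _ _ C _ _ _ _ b b' (act a m) n p s em) -sa_core_mul.
by rewrite /sa_core; congr (sa_out _ _ _ _ (ca_inv C (sg b _ b'))).
Qed.

Lemma assoc_sa_out (m : M) (n : N) (p : P) w :
  assoc C M N P (sa_out B m n p w) = as_out B m n p (ca C w).
Proof.
elim/sa_out_ind: w => [|r b b' a y ih]; first by rewrite !hom0.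
rewrite !homD !homZ ih sa_outE; congr (_ *: _ + _).
rewrite /= assoc_sg as_midE.
have [s [_ [ep ea]]] := locally_ex
  (locally_and (act_local (act a p)) (act_local (a : areg A))).
rewrite (@as_core_lunit _ _ _ _ _ C _ _ _ _ b b' m n (act a p) s ep) -as_core_mul.
by rewrite /as_core; congr (as_out _ _ _ _ (ca C (sg b b' _))).
Qed.

Lemma assocK : cancel (assoc C M N P) (assocV C M N P).
Proof.
elim/star_amod_ind => [|r b u p y ih]; first by rewrite !hom0.
rewrite !homD !homZ ih; congr (_ *: _ + _) => {y ih}.
elim/star_amod_ind: u => [|s b' m n y ih].
  have -> : sg b (0 : star B M N) p = 0 by rewrite -(scale0r (0 : star B M N)) sg_Z2 scale0r.
  by rewrite !hom0.
rewrite sg_D2 sg_Z2 !homD !homZ ih; congr (_ *: _ + _).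
rewrite /= assoc_sg as_midE /as_core.
rewrite -[LHS]/(assocV C M N P (as_out B m n p (ca C (sg b b' (lunit p : areg A))))).
rewrite assocV_as_out (caK C).
rewrite sa_outE.
by rewrite (lunit_act p).
Qed.

Lemma assocVK : cancel (assocV C M N P) (assoc C M N P).
Proof.
elim/star_amod_ind => [|r b m u y ih]; first by rewrite !hom0.
rewrite !homD !homZ ih; congr (_ *: _ + _) => {y ih}.
elim/star_amod_ind: u => [|s b' n p y ih].
  have -> : sg b m (0 : star B N P) = 0 by rewrite -(scale0r (0 : star B N P)) sg_Z3 scale0r.
  by rewrite !hom0.
rewrite sg_D3 sg_Z3 !homD !homZ ih; congr (_ *: _ + _).
rewrite /= assocV_sg sa_midE /sa_core.
rewrite -[LHS]/(assoc C M N P (sa_out B m n p (ca_inv C (sg b (lunit m : areg A) b')))).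
rewrite assoc_sa_out (ca_invK C).
rewrite as_outE.
by rewrite (lunit_act m).
Qed.

End AssociatorInverse.

(** * Torsion-freeness of star products *)

Section TensorSquareAlgebra.
Variables (k : fieldType) (Gam : nmodType) (A : lu_algebra k Gam).
Local Notation T := (tens A A).
Implicit Types x y z : T.

Lemma tmul_tmk (a b a' b' : A) :
  tmul (tmk a b : T) (tmk a' b') = tmk (la_mul a a') (la_mul b b').
Proof. by rewrite /tmul !tens_liftE. Qed.

Lemma tmulPl c x x' y : tmul (c *: x + x') y = c *: tmul x y + tmul x' y :> T.
Proof. exact: tens_lift_lin. Qed.

Lemma tmul0l y : tmul 0 y = 0 :> T.
Proof. by apply: (addIr (tmul 0 y)); rewrite -{1}[tmul 0 y]scale1r -tmulPl scale1r !add0r. Qed.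

Lemma tmulPr c x y y' : tmul x (c *: y + y') = c *: tmul x y + tmul x y' :> T.
Proof.
elim/tens_ind: x => [|d a b x ih]; first by rewrite !tmul0l scaler0 addr0.
have tE w : tmul (tmk a b) w = tens_lift (tmul_in_bilin a b) w by exact: tens_liftE.
by rewrite !tmulPl ih !tE tens_lift_lin !scalerDr !scalerA [d * c]mulrC addrACA.
Qed.

Lemma tmul0r x : tmul x 0 = 0 :> T.
Proof. by apply: (addIr (tmul x 0)); rewrite -{1}[tmul x 0]scale1r -tmulPr scale1r !add0r. Qed.

Lemma tmulA x y z : tmul x (tmul y z) = tmul (tmul x y) z.
Proof.
elim/tens_ind: x => [|d a b x ih]; first by rewrite !tmul0l.
rewrite !tmulPl ih; congr (_ *: _ + _) => {x ih d}.
elim/tens_ind: y => [|d a' b' y ih]; first by rewrite tmul0l tmul0r tmul0l.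
rewrite !(tmulPl, tmulPr) ih; congr (_ *: _ + _) => {y ih d}.
elim/tens_ind: z => [|d a'' b'' z ih]; first by rewrite !tmul0r.
by rewrite !tmulPr ih !tmul_tmk !la_mulA.
Qed.

Lemma tone_mulC g h x : tmul (tone A g h) x = tmul x (tone A g h).
Proof.
elim/tens_ind: x => [|d a b x ih]; first by rewrite tmul0l tmul0r.
by rewrite tmulPl tmulPr ih !tmul_tmk !la_oneC.
Qed.

Lemma tone_idem g h : tmul (tone A g h) (tone A g h) = tone A g h.
Proof. by rewrite tmul_tmk !la_one_orth !eqxx. Qed.

Section TensorAction.
Variables (R : base_ring k) (M N : amod A R).
Local Notation W := (restr_type (br_in R) (tens M N)).

Lemma tact_bilin (m : M) (n : N) :
  bilin (fun a a' : A => tmk (act a m) (act a' n) : W).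
Proof.
split=> [y c a a'|a c y y']; rewrite actDl actZl ?tmkDl ?tmkZl ?tmkDr ?tmkZr;
  by rewrite -[(c *: _ : W)]/(br_in R c *: _ : tens M N).
Qed.

Definition tact (t : T) (m : M) (n : N) : tens M N := tens_lift (tact_bilin m n) t.

Lemma tact_tmk a a' m n : tact (tmk a a') m n = tmk (act a m) (act a' n).
Proof. exact: (tens_liftE (tact_bilin m n)). Qed.

Lemma tactP c t t' m n : tact (c *: t + t') m n = br_in R c *: tact t m n + tact t' m n.
Proof. exact: (tens_lift_lin (tact_bilin m n)). Qed.

Lemma tact0 m n : tact 0 m n = 0.
Proof.
apply: (addIr (tact 0 m n)).
by rewrite -{1}[tact 0 m n]scale1r -(rmorph1 (br_in R)) -tactP scale1r !add0r.
Qed.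

Lemma tactDl t m m' n : tact t (m + m') n = tact t m n + tact t m' n.
Proof.
elim/tens_ind: t => [|d a b x ih]; first by rewrite !tact0 addr0.
by rewrite !tactP ih !tact_tmk actDr tmkDl scalerDr addrACA.
Qed.

Lemma tactDr t m n n' : tact t m (n + n') = tact t m n + tact t m n'.
Proof.
elim/tens_ind: t => [|d a b x ih]; first by rewrite !tact0 addr0.
by rewrite !tactP ih !tact_tmk actDr tmkDr scalerDr addrACA.
Qed.

Lemma tactZl r t m n : tact t (r *: m) n = r *: tact t m n.
Proof.
elim/tens_ind: t => [|d a b x ih]; first by rewrite !tact0 scaler0.
by rewrite !tactP ih !tact_tmk actZr tmkZl scalerDr !scalerA mulrC.
Qed.

Lemma tactZr r t m n : tact t m (r *: n) = r *: tact t m n.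
Proof.
elim/tens_ind: t => [|d a b x ih]; first by rewrite !tact0 scaler0.
by rewrite !tactP ih !tact_tmk actZr tmkZr scalerDr !scalerA mulrC.
Qed.

Lemma tact_tmul t a a' m n : tact (tmul t (tmk a a')) m n = tact t (act a m) (act a' n).
Proof.
elim/tens_ind: t => [|d b b' x ih]; first by rewrite tmul0l !tact0.
by rewrite tmulPl !tactP ih tmul_tmk !tact_tmk !actM.
Qed.

End TensorAction.
End TensorSquareAlgebra.

Definition functional (R : comNzRingType) (V : lmodType R) (f : V -> R) :=
  forall r x y, f (r *: x + y) = r * f x + f y.

Definition torsionless (R : comNzRingType) (V : lmodType R) :=
  forall x : V, (forall f : V -> R, functional f -> f x = 0) -> x = 0.

Section Torsionless.
Variables (k : fieldType) (Gam : nmodType) (A : lu_algebra k Gam).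
Variables (B : star_bimod A) (R : base_ring k).

Lemma ract_coords g h : exists (r : nat) (e : 'I_r -> B) (c : B -> 'I_r -> tens A A),
  [/\ forall b, ract b (tone A g h) = \sum_i ract (e i) (c b i),
      forall b b' i, c (b + b') i = c b i + c b' i,
      forall a b i, c (a *: b) i = a *: c b i
    & forall b t i, c (ract b t) i = tmul (c b i) t].
Proof.
have [r [e [_ eP]]] := ract_free B g h; exists r, e.
have {}eP b : exists! c : {ffun 'I_r -> tens A A},
    (forall i, tmul (tone A g h) (c i) = c i) /\
    ract b (tone A g h) = \sum_i ract (e i) (c i).
  by apply: eP; rewrite ractM tone_idem.
pose c b := projT1 (cid (eP b)).
have cP b : (forall i, tmul (tone A g h) (c b i) = c b i) /\
    ract b (tone A g h) = \sum_i ract (e i) (c b i) by case: (projT2 (cid (eP b))).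
have cU b (c' : 'I_r -> tens A A) : (forall i, tmul (tone A g h) (c' i) = c' i) ->
    ract b (tone A g h) = \sum_i ract (e i) (c' i) -> forall i, c b i = c' i.
  move=> h1 h2 i; case: (projT2 (cid (eP b))) => _ /(_ [ffun i => c' i]).
  rewrite -/(c b) => -> ; first by rewrite ffunE.
  split=> [j|]; first by rewrite ffunE.
  by rewrite h2; apply: eq_bigr => j _; rewrite ffunE.
exists (fun b i => c b i); split=> [b|b b' i|a b i|b t i]; first by case: (cP b).
- apply: (cU _ (fun i => c b i + c b' i)) => [j|].
    by rewrite -{1}[c b j]scale1r tmulPr scale1r !(cP _).1.
  by rewrite ractDl !(cP _).2 -big_split /=; apply: eq_bigr => j _; rewrite ractDr.
- apply: (cU _ (fun i => a *: c b i)) => [j|].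
    by rewrite -{1}[a *: c b j]addr0 tmulPr tmul0r addr0 (cP _).1.
  by rewrite ractZl (cP _).2 scaler_sumr; apply: eq_bigr => j _; rewrite ractZr.
- apply: (cU _ (fun i => tmul (c b i) t)) => [j|]; first by rewrite tmulA (cP _).1.
  rewrite ractM -tone_mulC -ractM (cP _).2.
  elim/big_ind2: _ => [|u u' v v' hu hv|j _]; first exact: ract0l.
    by rewrite ractDl hu hv.
  by rewrite ractM.
Qed.

Lemma free_coords (L : amod A R) : free_of_finite_rank L ->
  exists n (e : 'I_n -> L) (c : 'I_n -> L -> R),
  (forall l, functional (c l)) /\ forall x, x = \sum_l c l x *: e l.
Proof.
case=> n [e eP]; exists n, e.
pose c x := projT1 (cid (eP x)).
have cP x : x = \sum_i c x i *: e i by case: (projT2 (cid (eP x))).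
have cU x (c' : 'I_n -> R) : x = \sum_i c' i *: e i -> forall i, c x i = c' i.
  move=> h2 i; case: (projT2 (cid (eP x))) => _ /(_ [ffun i => c' i]).
  rewrite -/(c x) => -> ; first by rewrite ffunE.
  by rewrite {1}h2; apply: eq_bigr => j _; rewrite ffunE.
exists (fun l x => c x l); split=> // l r x y.
apply: (cU _ (fun l => r * c x l + c y l)).
rewrite {1}[x]cP {1}[y]cP scaler_sumr -big_split /=.
by apply: eq_bigr => i _; rewrite scalerDl scalerA.
Qed.

Lemma free_torsionless (L : amod A R) : free_of_finite_rank L -> torsionless L.
Proof.
move=> /free_coords [n [e [c [cf cP]]]] x fx; rewrite [x]cP big1 // => l _.
by rewrite fx ?scale0r.
Qed.

Variables (L N : amod A R).

Lemma sg_one_bal g h : @balanced k Gam A B R L N R (bm_id R) (star B L N)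
  (fun b m n => sg b (act (la_one A g) m) (act (la_one A h) n)).
Proof.
split=> *.
- by rewrite sg_D1.
- by rewrite actDr sg_D2.
- by rewrite actDr sg_D3.
- by rewrite sg_Z1.
- by rewrite actZr sg_Z2.
- by rewrite actZr sg_Z3.
- by rewrite sg_bal -!actM !la_oneC.
Qed.

Definition star_one g h : star B L N -> star B L N := star_lift (sg_one_bal g h).

Lemma star_oneE g h b m n :
  star_one g h (sg b m n) = sg b (act (la_one A g) m) (act (la_one A h) n).
Proof. exact: star_liftE. Qed.
Lemma star_oneD g h x y : star_one g h (x + y) = star_one g h x + star_one g h y.
Proof. exact: star_liftD. Qed.
Lemma star_oneZ g h r x : star_one g h (r *: x) = r *: star_one g h x.
Proof. exact: star_liftZ. Qed.
Lemma star_one0 g h : star_one g h 0 = 0.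
Proof. exact: star_lift0. Qed.

Lemma sg_suml (I : Type) (s : seq I) (F : I -> L) b (n : N) :
  sg b (\sum_(i <- s) F i) n = \sum_(i <- s) (sg b (F i) n : star B L N).
Proof.
elim: s => [|i s ih]; last by rewrite !big_cons sg_D2 ih.
by rewrite !big_nil -(scale0r (0 : L)) sg_Z2 scale0r.
Qed.
Lemma sg_sumr (I : Type) (s : seq I) (F : I -> N) b (m : L) :
  sg b m (\sum_(i <- s) F i) = \sum_(i <- s) (sg b m (F i) : star B L N).
Proof.
elim: s => [|i s ih]; last by rewrite !big_cons sg_D3 ih.
by rewrite !big_nil -(scale0r (0 : N)) sg_Z3 scale0r.
Qed.

Lemma star_one_sum (x : star B L N) : exists s : seq Gam,
  x = \sum_(g <- s) \sum_(h <- s) star_one g h x.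
Proof.
suff [s /(_ (undup s) (undup_uniq s)) h] : exists s : seq Gam, forall t, uniq t ->
    {subset s <= t} -> x = \sum_(g <- t) \sum_(h <- t) star_one g h x.
  by exists (undup s); apply: h => y; rewrite mem_undup.
elim/star_amod_ind: x => [|r b m n y [s hs]].
  exists [::] => t _ _; rewrite big1 // => g _; rewrite big1 // => h _.
  exact: star_one0.
have [s' hs'] := locally_and (act_local m) (act_local n).
exists (s ++ s') => t ut st; rewrite [in LHS](hs t) //; last first.
  by move=> z zs; apply: st; rewrite mem_cat zs.
have [em en] : act (punit A t) m = m /\ act (punit A t) n = n.
  by apply: hs' => // z zs; apply: st; rewrite mem_cat zs orbT.
rewrite -{1}em -{1}en !act_suml sg_suml scaler_sumr -big_split /=.
apply: eq_bigr => g _; rewrite sg_sumr scaler_sumr -big_split /=.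
by apply: eq_bigr => h _; rewrite star_oneD star_oneZ star_oneE.
Qed.

Section Component.
Variables (g h : Gam) (r : nat) (e : 'I_r -> B) (c : B -> 'I_r -> tens A A).
Hypothesis cE : forall b, ract b (tone A g h) = \sum_i ract (e i) (c b i).
Hypothesis cD : forall b b' i, c (b + b') i = c b i + c b' i.
Hypothesis cZ : forall a b i, c (a *: b) i = a *: c b i.
Hypothesis cM : forall b t i, c (ract b t) i = tmul (c b i) t.

Lemma component_bal i : @balanced k Gam A B R L N R (bm_id R) (tens L N)
  (fun b m n => tact (c b i) m n).
Proof.
split=> *.
- by rewrite cD -{1}[c _ _]scale1r tactP rmorph1 scale1r.
- exact: tactDl.
- exact: tactDr.
- by rewrite cZ -{1}[_ *: c _ _]addr0 tactP tact0 addr0.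
- exact: tactZl.
- exact: tactZr.
- by rewrite cM tact_tmul.
Qed.
Definition component i : star B L N -> tens L N := star_lift (component_bal i).

Lemma component_lin i a x y : component i (a *: x + y) = a *: component i x + component i y.
Proof. by rewrite /component star_liftD star_liftZ. Qed.

Lemma sg_bilin b : bilin (fun m n => sg b m n : star B L N).
Proof.
split=> [n a m m'|m a n n']; first by rewrite sg_D2 sg_Z2.
by rewrite sg_D3 sg_Z3.
Qed.
Definition of_component i : tens L N -> star B L N := tens_lift (sg_bilin (e i)).

Lemma of_component_lin i a x y :
  of_component i (a *: x + y) = a *: of_component i x + of_component i y.
Proof. exact: tens_lift_lin. Qed.
Lemma of_component0 i : of_component i 0 = 0.
Proof.
apply: (addIr (of_component i 0)).
by rewrite -{1}[of_component i 0]scale1r -of_component_lin scale1r !add0r.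
Qed.

Lemma of_component_tact i t m n :
  of_component i (tact t m n) = sg (ract (e i) t) m n.
Proof.
elim/tens_ind: t => [|d a b x ih].
  rewrite tact0 of_component0 ract0r -(scale0r (0 : B)) sg_Z1 rmorph0.
  by rewrite scale0r.
rewrite tactP of_component_lin ih tact_tmk ractDr ractZr.
rewrite sg_D1 sg_Z1 sg_bal; congr (_ *: _ + _).
exact: (tens_liftE (sg_bilin (e i))).
Qed.

Lemma star_one_component x : star_one g h x = \sum_i of_component i (component i x).
Proof.
elim/star_amod_ind: x => [|a b m n y ih].
  rewrite star_one0 big1 // => i _.
  by rewrite /component star_lift0 of_component0.
rewrite star_oneD star_oneZ ih star_oneE -sg_bal.
rewrite -[tmk _ _]/(tone A g h) cE.
have -> : sg (\sum_i ract (e i) (c b i)) m n =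
    \sum_i (sg (ract (e i) (c b i)) m n : star B L N).
  elim/big_ind2: _ => [|u u' v v' hu hv|//]; last by rewrite -hu -hv sg_D1.
  by rewrite -(scale0r (0 : B)) sg_Z1 rmorph0 scale0r.
rewrite scaler_sumr -big_split /=; apply: eq_bigr => i _.
rewrite component_lin of_component_lin; congr (_ *: _ + _).
by rewrite -of_component_tact; congr (of_component i _); rewrite /component star_liftE.
Qed.

End Component.

Lemma coord_bilin (c : L -> R) : functional c -> bilin (fun m (n : N) => c m *: n).
Proof.
move=> cf; split=> [n a m m'|m a n n']; first by rewrite cf scalerDl scalerA.
by rewrite scalerDr !scalerA mulrC.
Qed.

Lemma tens_torsionless : free_of_finite_rank L -> torsionless N -> torsionless (tens L N).
Proof.
move=> /free_coords [n [e [c [cf cP]]]] tN x fx.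
have tE y : y = \sum_l tmk (e l) (tens_lift (coord_bilin (cf l)) y).
  have lift0 l : tens_lift (coord_bilin (cf l)) 0 = 0.
    apply: (addIr (tens_lift (coord_bilin (cf l)) 0)).
    by rewrite -{1}[tens_lift _ 0]scale1r -tens_lift_lin scale1r !add0r.
  have tmk0 l : tmk (e l) (0 : N) = 0 by rewrite -(scale0r (0 : N)) tmkZr scale0r.
  elim/tens_ind: y => [|a u v y ih].
    by rewrite big1 // => l _; rewrite lift0 tmk0.
  rewrite {1}ih {1}[u]cP.
  have -> : tmk (\sum_l c l u *: e l) v = \sum_l tmk (c l u *: e l) v.
    elim/big_ind2: _ => [|m m' w w' hm hw|//]; last by rewrite tmkDl hm hw.
    by rewrite -(scale0r (0 : L)) tmkZl scale0r.
  rewrite scaler_sumr -big_split /=; apply: eq_bigr => l _.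
  by rewrite tens_lift_lin tens_liftE tmkDr !tmkZr tmkZl.
rewrite [x]tE big1 // => l _.
suff -> : tens_lift (coord_bilin (cf l)) x = 0.
  by rewrite -(scale0r (0 : N)) tmkZr scale0r.
apply: tN => f ff; apply: (fx (f \o tens_lift (coord_bilin (cf l)))) => a y z /=.
by rewrite tens_lift_lin ff.
Qed.

Lemma star_torsionless : free_of_finite_rank L -> torsionless N -> torsionless (star B L N).
Proof.
move=> fL tN x fx; have tT := tens_torsionless fL tN.
have [s ->] := star_one_sum x; rewrite big1 // => g _; rewrite big1 // => h _.
have [r [e [c [cE cD cZ cM]]]] := ract_coords g h.
rewrite (star_one_component cE cD cZ cM) big1 // => i _.
suff -> : component cD cZ cM i x = 0 by rewrite of_component0.
apply: tT => f ff; apply: (fx (f \o component cD cZ cM i)) => a y z /=.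
by rewrite component_lin ff.
Qed.

End Torsionless.

(** * Reduction modulo z *)

Section ReductionModZ.
Variables (k : fieldType) (Gam : nmodType) (A : lu_algebra k Gam).
Variables (eps : augmentation A) (B : star_bimod A).
Local Notation O := (BO k).
Local Notation z := (ps_z k : O).

Definition zmultiple (V : lmodType O) (v : V) : Prop := exists w, v = z *: w.

Lemma span_zmultiple (V : lmodType O) (v : V) : span (@zmultiple V) v -> zmultiple v.
Proof.
elim=> [|r _ y [w ->] _ [w' ->]]; first by exists 0; rewrite scaler0.
by exists (r *: w + w'); rewrite scalerDr !scalerA mulrC.
Qed.

Lemma lproj_zmultiple (V : lmodType O) (v w : V) :
  lproj (@zmultiple V) v = lproj (@zmultiple V) w <-> zmultiple (v - w).
Proof.
split=> [/lprojP/span_zmultiple//|h]; apply/lprojP; exact: span_gen.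
Qed.

Lemma pseries_shift (r : O) : exists s : O, r = ps_const (ps_ev0 r) + z * s.
Proof.
exists (fun n => r n.+1); apply/funext => n.
rewrite -[RHS]/(ps_const (ps_ev0 r) n + ps_mul (ps_z k) (fun n => r n.+1) n).
rewrite /ps_mul /ps_z; case: n => [|n]; first by rewrite big_ord1 mul0r addr0.
rewrite !big_ord_recl /= mul0r add0r mul1r subSS subn0 big1 ?addr0 ?add0r // => i _.
by rewrite mul0r.
Qed.

Lemma bm_ev0_z : bm_ev0 k z = 0.
Proof. by []. Qed.

Definition reduction (M : amod A O) (M' : amod A (Bk k)) (f : hom (bm_ev0 k) M M') :=
  (forall y, exists x, f x = y) /\ (forall x, f x = 0 -> zmultiple x).

Lemma hom_zmultiple (M : amod A O) (M' : amod A (Bk k)) (f : hom (bm_ev0 k) M M') x :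
  zmultiple x -> f x = 0.
Proof. by case=> w ->; rewrite homZ bm_ev0_z scale0r. Qed.

Lemma bc_in_reduction (M : amod A O) : reduction (bc_in (bm_ev0 k) M).
Proof.
split=> [|x].
  elim/bc_ind => [|a m y [x <-]]; first by exists 0; rewrite hom0.
  by exists (ps_const a *: m + x); rewrite homD homZ.
pose W : lmodType (Bk k) := restr_type (br_in O) (lquot (@zmultiple M)).
pose pr : M -> W := lproj (@zmultiple M).
have prD u v : pr (u + v) = pr u + pr v by exact: lprojD.
have prZ r u : pr (r *: u) = bm_ev0 k r *: pr u.
  have [s rs] := pseries_shift r.
  rewrite -[RHS]/(ps_const (ps_ev0 r) *: lproj (@zmultiple M) u).
  rewrite -lprojZ; apply/lproj_zmultiple.
  exists (s *: u); rewrite {1}rs scalerDl addrAC subrr add0r.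
  by rewrite scalerA.
move=> x0; have /lproj_zmultiple : pr x = pr 0.
  have liftE := @bc_liftE _ _ _ _ _ (bm_ev0 k) M W pr prD prZ.
  by rewrite -!liftE; congr bc_lift; rewrite [LHS]x0 -(hom0 (bc_in (bm_ev0 k) M)).
by rewrite subr0.
Qed.

Lemma hcomp_reduction (M : amod A O) (M' N : amod A (Bk k))
    (f : hom (bm_ev0 k) M M') (g : mhom M' N) :
  reduction f -> is_iso g -> reduction (hcomp g f).
Proof.
case=> fs fk [g' gK g'K]; split=> [y|x /= e0].
  by have [x fx] := fs (g' y); exists x; rewrite /= fx g'K.
by apply: fk; rewrite -[f x]gK e0 -(hom0 g) gK.
Qed.

Section StarMap.
Variables (M N : amod A O) (M' N' : amod A (Bk k)).
Variables (f : hom (bm_ev0 k) M M') (g : hom (bm_ev0 k) N N').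
Hypotheses (fr : reduction f) (gr : reduction g).
Local Notation pr := (lproj (@zmultiple (star B M N))).

Lemma lproj_sg b m m' n n' : f m = f m' -> g n = g n' ->
  pr (sg b m n) = pr (sg b m' n').
Proof.
move=> fm gn; have [w mE] : zmultiple (m - m').
  by apply: fr.2; rewrite homD homN fm subrr.
have [v nE] : zmultiple (n - n') by apply: gr.2; rewrite homD homN gn subrr.
apply/lproj_zmultiple; exists (sg b w n + sg b m' v).
rewrite -(subrK m' m) -(subrK n' n) mE nE sg_D2 sg_Z2 sg_D3 sg_Z3 sg_D3 sg_Z3.
by rewrite addrA addrK !scalerDr.
Qed.

Let F y := projT1 (cid (fr.1 y)).
Let FK y : f (F y) = y. Proof. exact: (projT2 (cid (fr.1 y))). Qed.
Let G y := projT1 (cid (gr.1 y)).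
Let GK y : g (G y) = y. Proof. exact: (projT2 (cid (gr.1 y))). Qed.

Lemma section_bal : @balanced k Gam A B (Bk k) M' N' O (bm_str O) (lquot (@zmultiple (star B M N)))
  (fun b m n => pr (sg b (F m) (G n))).
Proof.
split=> *.
- by rewrite sg_D1 lprojD.
- by rewrite -lprojD -sg_D2; apply: lproj_sg; rewrite ?homD !(FK, GK).
- by rewrite -lprojD -sg_D3; apply: lproj_sg; rewrite ?homD !(FK, GK).
- by rewrite sg_Z1 lprojZ.
- by rewrite -lprojZ -sg_Z2; apply: lproj_sg; rewrite ?homZ !(FK, GK).
- by rewrite -lprojZ -sg_Z3; apply: lproj_sg; rewrite ?homZ !(FK, GK).
- by rewrite sg_bal; apply: lproj_sg; rewrite homA !(FK, GK).
Qed.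

Lemma star_map_reduction : reduction (star_map B f g).
Proof.
split=> [|x x0].
  elim/star_amod_ind => [|r b m n y [x <-]]; first by exists 0; rewrite hom0.
  exists (ps_const r *: sg b (F m) (G n) + x).
  by rewrite homD homZ star_mapE FK GK.
have liftK y : star_lift section_bal (star_map B f g y) = pr y.
  elim/star_amod_ind: y => [|r b m n y ih].
    by rewrite hom0 star_lift0 lproj0.
  rewrite homD homZ star_mapE star_liftD star_liftZ star_liftE ih lprojD lprojZ.
  congr (_ + _); rewrite (lproj_sg _ (FK _) (GK _)).
  have [s rs] := pseries_shift r.
  rewrite -!(lprojZ (@zmultiple _)); apply/lproj_zmultiple.
  exists (- (s *: sg b m n)). rewrite [X in _ - X *: _]rs scalerDl opprD addrA.
  rewrite -[X in X *: _ - _]/(ps_const (ps_ev0 r) : O) subrr add0r.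
  by rewrite scalerN scalerA.
have /lproj_zmultiple : pr x = pr 0 by rewrite -!liftK x0 hom0.
by rewrite subr0.
Qed.
End StarMap.

Lemma unit_map_reduction : reduction (unit_map eps (bm_ev0 k)).
Proof.
split=> [y|x x0]; first by exists (ps_const y).
have [s xs] := pseries_shift x; exists s.
by rewrite {1}xs -[ps_ev0 x]/(unit_map eps (bm_ev0 k) x) x0 raddf0 add0r.
Qed.

Section Deformation.
Variables (C : serre_subcat eps B) (J : pred int) (L : idx J -> obj C).
Variable D : gc_deformation L.

Lemma ev0_reduction e : reduction (ev0 D e).
Proof.
elim: e => [|j e ih]; first exact: unit_map_reduction.
apply: star_map_reduction ih; apply: hcomp_reduction; first exact: bc_in_reduction.
exact: gc_spec_iso.
Qed.

Lemma star_seq_torsionless e : torsionless (star_seq eps B (gc_L D) e).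
Proof.
elim: e => [|j e ih]; last by apply: star_torsionless ih; exact: gc_free.
by move=> x /(_ id); apply=> r u v.
Qed.

Lemma gc_star_torsionless i j : torsionless (star B (gc_L D i) (gc_L D j)).
Proof. by apply: star_torsionless; last apply: free_torsionless; exact: gc_free. Qed.

End Deformation.
End ReductionModZ.

(** * R-matrices on lattices *)

Section Lattices.
Variables (k : fieldType) (Gam : nmodType) (A : lu_algebra k Gam).
Variables (eps : augmentation A) (B : star_bimod A).
Local Notation O := (BO k).
Local Notation K := (BK k).
Local Notation z := (ps_z k : O).
Local Notation OK := (bm_OK k).
Local Notation inK M := (bc_in (bm_OK k) M).

Lemma z_neq0 : (ps_z k : pseries k) != 0.
Proof.
apply/eqP => /(congr1 (fun f : pseries k => f 1%N)) /eqP.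
by rewrite /ps_z eqxx oner_eq0.
Qed.

Lemma zpowD m n : zpow k (m + n) = zpow k m * zpow k n.
Proof. by rewrite /zpow expfzDr // tofrac_eq0 z_neq0. Qed.

Lemma zpow_nat (n : nat) : zpow k n%:Z = OK (z ^+ n).
Proof. by rewrite /zpow -exprnP rmorphXn. Qed.

Lemma zpow0 : zpow k 0 = 1.
Proof. by []. Qed.

Lemma inK_inj (M : amod A O) : torsionless M -> injective (inK M).
Proof.
move=> tM x y xy; apply/eqP; rewrite -subr_eq0; apply/eqP; apply: tM => f ff.
pose g : M -> (K : comNzRingType)^o := fun v => OK (f v).
have f0 : f 0 = 0.
  by apply: (addIr (f 0)); rewrite -{1}[f 0]mul1r -ff scale1r !add0r.
have gD u v : g (u + v) = g u + g v.
  by rewrite /g -[u]scale1r ff mul1r rmorphD scale1r.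
have gZ r u : g (r *: u) = OK r *: g u.
  by rewrite /g -[r *: u]addr0 ff f0 addr0 rmorphM.
have gE v : bc_lift gD gZ (inK M v) = g v by exact: bc_liftE.
have xy0 : inK M (x - y) = inK M 0 by rewrite homD homN xy subrr hom0.
have /eqP : OK (f (x - y)) = 0.
  by rewrite -[LHS]/(g (x - y)) -gE xy0 gE /g f0 rmorph0.
by rewrite [_ == 0]tofrac_eq0 => /eqP.
Qed.

Lemma zpow_inK_inj (M : amod A O) n (x y : bc OK M) :
  zpow k n *: x = zpow k n *: y -> x = y.
Proof.
by move=> /(congr1 ( *:%R (zpow k (- n)))); rewrite !scalerA -zpowD addNr zpow0 !scale1r.
Qed.

Lemma zpow_inK (M : amod A O) n (m : nat) (x : M) :
  zpow k n *: inK M (z ^+ m *: x) = zpow k (n + m%:Z) *: inK M x.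
Proof. by rewrite homZ scalerA zpowD zpow_nat. Qed.

Lemma inK_zX (M : amod A O) (m : nat) (x : M) : inK M (z ^+ m *: x) = zpow k m%:Z *: inK M x.
Proof. by rewrite homZ zpow_nat. Qed.

Lemma star_mapl_scalar (M M' N : amod A O) (f : mhom M' M) (f' : mhom M M') (r : O) :
  (forall m, f (f' m) = r *: m) ->
  forall x, star_map B f (hid N) (star_map B f' (hid N) x) = r *: x.
Proof.
move=> ff; elim/star_amod_ind => [|s b m n y ih]; first by rewrite !hom0 scaler0.
by rewrite !homD !homZ ih scalerDr !star_mapE ff sg_Z2 !scalerA mulrC.
Qed.

Lemma star_mapr_scalar (M N N' : amod A O) (f : mhom N' N) (f' : mhom N N') (r : O) :
  (forall m, f (f' m) = r *: m) ->
  forall x, star_map B (hid M) f (star_map B (hid M) f' x) = r *: x.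
Proof.
move=> ff; elim/star_amod_ind => [|s b m n y ih]; first by rewrite !hom0 scaler0.
by rewrite !homD !homZ ih scalerDr !star_mapE ff sg_Z3 !scalerA mulrC.
Qed.

Section Scaling.
Variables (M : amod A O) (r : O).
Fact scale_homZ s (x : M) : r *: (s *: x) = bm_id O s *: (r *: x).
Proof. by rewrite !scalerA mulrC. Qed.
Definition scale_hom : mhom M M :=
  @Hom _ _ _ _ _ (bm_id O) M M (fun x => r *: x) (fun x y => scalerDr r x y) scale_homZ
    (fun a x => esym (actZr a r x)).
End Scaling.

(* Up to the factor z^c the two maps are inverse isomorphisms after inverting z; the two
   one-sided inverses of f may differ by a unit of O. *)
Definition quasi_iso (M N : amod A O) (f : mhom M N) := exists c : nat,
  (exists g : mhom N M, forall y, f (g y) = z ^+ c *: y) /\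
  (exists g : mhom N M, forall x, g (f x) = z ^+ c *: x).

Lemma quasi_iso_id (M : amod A O) : quasi_iso (hid M).
Proof. by exists 0%N; split; exists (hid M) => x; rewrite expr0 scale1r. Qed.

Lemma quasi_iso_comp (M N P : amod A O) (f : mhom N P) (h : mhom M N) :
  quasi_iso f -> quasi_iso h -> quasi_iso (hcomp f h).
Proof.
move=> [c [[g gr] [g' gl]]] [d [[h1 hr] [h2 hl]]]; exists (c + d)%N; split.
  by exists (hcomp h1 g) => y; rewrite /= hr homZ gr /= scalerA -exprD addnC.
by exists (hcomp h2 g') => x; rewrite /= gl homZ hl /= scalerA -exprD.
Qed.

Section Steps.
Variables (C : serre_subcat eps B) (J : pred int) (L : idx J -> obj C).
Variables (D : gc_deformation L) (Rm : r_matrices D) (Co : constraints eps B).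
Variables (al : idx J -> idx J -> nat) (Hal : is_alpha Rm al).
Local Notation Lt := (gc_L D).
Local Notation MO := (star_seq eps B Lt).

Lemma rm_latK i j : exists u : O, is_unitO u /\
  forall x, rm_lat Rm i j (rm_lat Rm j i x) = (u * z ^+ al i j) *: x.
Proof.
have [u [uu uE]] := Hal i j; exists u; split=> // x.
apply: (inK_inj (@gc_star_torsionless _ _ _ _ _ _ _ _ D j i)).
by rewrite -rm_latP -rm_latP uE homZ rmorphM zpow_nat.
Qed.

Lemma rm_stepK_scalar s i j t : exists u : O, is_unitO u /\
  forall x, rm_step Rm Co s i j t (rm_step Rm Co s j i t x) = (u * z ^+ al i j) *: x.
Proof.
have [u [uu uE]] := rm_latK i j; exists u; split=> //.
elim: s => [|a s ih] x.
  pose F := assoc Co (Lt j) (Lt i) (MO t).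
  pose w := assocV Co (Lt j) (Lt i) (MO t) x.
  pose S1 := star_map B (rm_lat Rm j i) (hid (MO t)).
  pose S2 := star_map B (rm_lat Rm i j) (hid (MO t)).
  transitivity (F (S2 (S1 w))).
    exact: (congr1 (fun y => F (S2 y)) (assocK Co (S1 w))).
  rewrite (star_mapl_scalar uE) homZ.
  exact: (congr1 ( *:%R (u * z ^+ al i j)) (assocVK Co x)).
exact: (@star_mapr_scalar (Lt a) (MO (s ++ [:: j, i & t])) (MO (s ++ [:: i, j & t]))
  (rm_step Rm Co s i j t) (rm_step Rm Co s j i t) (u * z ^+ al i j) ih x).
Qed.

Lemma rm_step_quasi_iso s i j t : quasi_iso (rm_step Rm Co s i j t).
Proof.
have [u [uu uE]] := rm_stepK_scalar s i j t.
have [v [vu vE]] := rm_stepK_scalar s j i t.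
have mulVr_scale (w : O) n m (M : amod A O) (x : M) : is_unitO w ->
    (w^-1 * z ^+ n) *: ((w * z ^+ m) *: x) = z ^+ (n + m) *: x.
  move=> wu; rewrite scalerA mulrACA.
  by rewrite (mulVr wu) mul1r exprD.
exists (al j i + al i j)%N; split.
  exists (hcomp (rm_step Rm Co s j i t) (scale_hom _ (u^-1 * z ^+ al j i))) => y.
  by rewrite /= !homZ uE /= mulVr_scale.
exists (hcomp (scale_hom _ (v^-1 * z ^+ al i j)) (rm_step Rm Co s j i t)) => y.
by rewrite /= vE mulVr_scale // addnC.
Qed.

Lemma rm_moves_lattice e e' (p : moves al e e') : exists f : mhom (MO e) (MO e'),
  quasi_iso f /\ forall x, rm_moves Rm Co p (inK _ x) = inK _ (f x).
Proof.
elim: p => [{}e|s i j t {}e' ok p [f [fq fE]]].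
  by exists (hid _); split; first exact: quasi_iso_id.
exists (hcomp f (rm_step Rm Co s i j t)); split.
  exact: quasi_iso_comp fq (rm_step_quasi_iso s i j t).
by move=> x; exact: etrans (congr1 (rm_moves Rm Co p) (bc_map_gen OK _ x)) (fE _).
Qed.

End Steps.
End Lattices.

(** * The Jantzen filtration *)

Section JantzenFiltration.
Variables (k : fieldType) (Gam : nmodType) (A : lu_algebra k Gam).
Variables (eps : augmentation A) (B : star_bimod A).
Variables (C : serre_subcat eps B) (J : pred int) (L : idx J -> obj C).
Variables (D : gc_deformation L) (Rm : r_matrices D) (Co : constraints eps B).
Variables (al : idx J -> idx J -> nat) (Hal : is_alpha Rm al).
Local Notation O := (BO k).
Local Notation z := (ps_z k : O).
Local Notation OK := (bm_OK k).
Local Notation MO := (star_seq eps B (gc_L D)).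
Local Notation inK M := (bc_in (bm_OK k) M).

Lemma scale_zX_inj e n (x y : MO e) : z ^+ n *: x = z ^+ n *: y -> x = y.
Proof.
move=> /(congr1 (inK (MO e))); rewrite !inK_zX => /zpow_inK_inj.
exact/inK_inj/star_seq_torsionless.
Qed.

Lemma zmultiple_iter (M : amod A O) : (forall x : M, zmultiple x) ->
  forall n (x : M), exists y, x = z ^+ n *: y.
Proof.
move=> zM; elim=> [|n ih] x; first by exists x; rewrite expr0 scale1r.
have [y ->] := ih x; have [w ->] := zM y.
by exists w; rewrite scalerA -exprSr.
Qed.

Lemma star_seq_eq0_moves es e (p : moves al es e) :
  (forall x : star_seq eps B L e, x = 0) -> forall x : star_seq eps B L es, x = 0.
Proof.
move=> e0 x; have [f [[c [_ [g gl]]] _]] := rm_moves_lattice Co Hal p.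
have [m <-] := (ev0_reduction D es).1 x; apply: hom_zmultiple.
have zM : forall y : MO e, zmultiple y by move=> y; apply: (ev0_reduction D e).2.
have [y fm] := zmultiple_iter zM c.+1 (f m).
exists (g y); apply: (@scale_zX_inj _ c).
by rewrite -gl fm homZ scalerA -exprSr.
Qed.

Variables (es e ec : seq (idx J)) (p : moves al es e) (q : moves al e ec).
Local Notation F := (jantzen Rm Co p q).

Lemma jantzen_decr n x : F (n + 1) x -> F n x.
Proof.
case=> m [mx [w [hw mw]]]; exists m; split; first exact: mx.
exists w; split; last exact: mw.
move=> b /hw [hu [v vE]]; split; first exact: hu.
by exists (z ^+ 1 *: v); rewrite zpow_inK addrAC.
Qed.

Lemma jantzen_full : exists n, forall x, F n x.
Proof.
have [f [[c [[g gr] _]] fE]] := rm_moves_lattice Co Hal p.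
have [f' [_ fE']] := rm_moves_lattice Co Hal q.
exists (- c%:Z) => x; have [m <-] := (ev0_reduction D e).1 x.
have lev : in_level Rm Co p q (- c%:Z) (- c%:Z) (inK (MO e) m).
  split; [exists (g m) | exists (f' m)].
    rewrite fE gr zpow_inK addNr zpow0 scale1r; reflexivity.
  rewrite fE' subrr zpow0 scale1r; reflexivity.
exists m; split; first by [].
exists [:: (- c%:Z, inK _ m)]; split; first by move=> b; rewrite inE => /eqP ->; exact: lev.
by rewrite big_cons big_nil; exact: esym (addr0 _).
Qed.

Lemma in_level_zmultiple : exists n, forall a y, in_level Rm Co p q n a y ->
  exists m : MO e, y = inK _ (z *: m).
Proof.
have [f [_ fE]] := rm_moves_lattice Co Hal p.
have [f' [[c [_ [g gl]]] fE']] := rm_moves_lattice Co Hal q.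
exists (c.+1)%:Z => a y [[u ->] [v]]; rewrite fE.
case: (intP a) => [|n|n] vE.
- move: vE; rewrite zpow0 scale1r fE' subr0 -inK_zX.
  move=> /(inK_inj (@star_seq_torsionless _ _ _ _ _ _ _ _ D ec)) vE.
  exists (g v); congr (inK _ _); apply: (@scale_zX_inj _ c).
  by rewrite -gl vE homZ scalerA -exprSr.
- exists (z ^+ n *: f u).
  rewrite -inK_zX scalerA -exprS; reflexivity.
move: vE; rewrite homZ fE' opprK => /(congr1 ( *:%R (zpow k n.+1%:Z))).
rewrite !scalerA -!zpowD subrr zpow0 scale1r -!PoszD -inK_zX.
move=> /(inK_inj (@star_seq_torsionless _ _ _ _ _ _ _ _ D ec)) vE.
have fu : f u = z ^+ (n.+1 + n.+2) *: g v.
  apply: (@scale_zX_inj _ c); rewrite -gl vE homZ scalerA -exprD.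
  congr (z ^+ _ *: _); rewrite addnCA addSnnS -addnS; reflexivity.
exists (z ^+ n.+1 *: g v).
rewrite fu zpow_inK scalerA -exprS inK_zX; congr (zpow k _ *: _).
rewrite PoszD addrA addNr add0r; reflexivity.
Qed.

Lemma jantzen_zero : exists n, forall x, F n x -> x = 0.
Proof.
have [n nP] := in_level_zmultiple; exists n => x [m [<- [w [hw mw]]]].
apply: hom_zmultiple; suff [m' m'E] : exists m', \sum_(b <- w) b.2 = inK (MO e) (z *: m').
  exists m'; apply: (inK_inj (@star_seq_torsionless _ _ _ _ _ _ _ _ D e)).
  by rewrite mw.
rewrite big_seq; elim/big_ind: _ => [|_ _ [m1 ->] [m2 ->]|b /hw/nP //].
  by exists 0; rewrite scaler0 hom0.
by exists (m1 + m2); rewrite scalerDr homD.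
Qed.

End JantzenFiltration.

(** * Dimension and the Grothendieck group *)

Section Dimension.
Variable F : fieldType.
Implicit Types V W X : lmodType F.

Definition spanning V n (e : 'I_n -> V) :=
  forall x, exists c : 'I_n -> F, x = \sum_i c i *: e i.
Definition independent V n (e : 'I_n -> V) :=
  forall c : 'I_n -> F, \sum_i c i *: e i = 0 -> forall i, c i = 0.
Definition has_dim V n := exists e : 'I_n -> V, spanning e /\ independent e.

Lemma spanning_has_dim V n (e : 'I_n -> V) : spanning e -> exists m, has_dim V m.
Proof.
elim: n e => [|n ih] e sp; first by exists 0%N, e; split=> // c _ [].
have [ind|/existsNP[c /not_implyP[c0 /existsNP[j /eqP cj]]]] := pselect (independent e).
  by exists n.+1, e.
apply: (ih (fun i => e (fintype.lift j i))) => x; have [b ->] := sp x.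
have ej : e j = \sum_i (- (c j)^-1 * c (fintype.lift j i)) *: e (fintype.lift j i).
  have -> : e j = (c j)^-1 *: (c j *: e j) by rewrite scalerA mulVf ?scale1r.
  move/eqP: c0; rewrite (bigD1_ord j) //= addr_eq0 => /eqP ->.
  rewrite scalerN -scaleNr scaler_sumr.
  by apply: eq_bigr => i _; rewrite scalerA.
exists (fun i => b j * (- (c j)^-1 * c (fintype.lift j i)) + b (fintype.lift j i)).
rewrite (bigD1_ord j) //= {1}ej scaler_sumr -big_split /=.
by apply: eq_bigr => i _; rewrite scalerDl !scalerA.
Qed.

Lemma independent_spanning_leq V n m (e : 'I_n -> V) (f : 'I_m -> V) :
  independent e -> spanning f -> (n <= m)%N.
Proof.
move=> ind sp; have /choice [a aE] : forall i, exists c : 'I_m -> F, e i = \sum_j c j *: f j.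
  by move=> i; apply: sp.
pose M : 'M[F]_(n, m) := \matrix_(i, j) a i j.
suff fr : row_free M by rewrite -(eqP fr) rank_leq_col.
apply: inj_row_free => v vM; apply/rowP => i; rewrite mxE; apply: ind.
under eq_bigr do rewrite aE scaler_sumr.
rewrite exchange_big big1 //= => j _.
have := congr1 (fun w : 'rV[F]_m => w 0 j) vM; rewrite !mxE => vj.
under eq_bigr do rewrite scalerA.
rewrite -scaler_suml (eq_bigr (fun l => v 0 l * M l j)) ?vj ?scale0r //.
by move=> l _; rewrite mxE.
Qed.

Lemma has_dim_unique V n m : has_dim V n -> has_dim V m -> n = m.
Proof.
move=> [e [se ie]] [f [sf jf]]; apply/eqP; rewrite eqn_leq.
by rewrite (independent_spanning_leq ie sf) (independent_spanning_leq jf se).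
Qed.

Lemma has_dim_exact V W X n m (f : V -> W) (g : W -> X) :
  linear f -> linear g -> injective f -> (forall y, exists x, g x = y) ->
  (forall y, g y = 0 <-> exists x, y = f x) ->
  has_dim V n -> has_dim X m -> has_dim W (n + m).
Proof.
move=> lf lg fi gs ex [e [se ie]] [e' [se' ie']].
have sumE (U U' : lmodType F) (h : U -> U') : linear h ->
    forall l (c : 'I_l -> F) (u : 'I_l -> U),
    h (\sum_i c i *: u i) = \sum_i c i *: h (u i).
  move=> lh l c u; have h0 : h 0 = 0.
    by apply: (addIr (h 0)); rewrite -{1}[h 0]scale1r -lh scale1r !add0r.
  elim/big_rec2: _ => // i x y _ <-; exact: lh.
have /choice [s sK] := gs.
pose b i := match split i with inl i => f (e i) | inr j => s (e' j) end.
have bl i : b (lshift m i) = f (e i) by rewrite /b -[lshift m i]/(unsplit (inl i)) unsplitK.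
have br j : b (rshift n j) = s (e' j) by rewrite /b -[rshift n j]/(unsplit (inr j)) unsplitK.
have bE c : \sum_i c i *: b i =
    f (\sum_i c (lshift m i) *: e i) + \sum_j c (rshift n j) *: s (e' j).
  rewrite big_split_ord /= (sumE _ _ f lf).
  by congr (_ + _); apply: eq_bigr => i _; rewrite ?bl ?br.
have gf x : g (f x) = 0 by apply/ex; exists x.
have gD x y : g (x + y) = g x + g y by rewrite -[x]scale1r lg !scale1r.
exists b; split=> [x|c].
  have [c' c'E] := se' (g x).
  have /ex [v vE] : g (x - \sum_j c' j *: s (e' j)) = 0.
    apply: (addIr (g (\sum_j c' j *: s (e' j)))); rewrite -gD subrK add0r.
    by rewrite (sumE _ _ g lg) c'E; apply: eq_bigr => j _; rewrite sK.
  have [c cE] := se v.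
  exists (fun i => match split i with inl i => c i | inr j => c' j end).
  rewrite bE -[x](subrK (\sum_j c' j *: s (e' j))) vE cE; congr (f _ + _).
    apply: eq_bigr => i _.
    by rewrite -[lshift m i]/(unsplit (inl i)) unsplitK.
  by apply: eq_bigr => j _; rewrite -[rshift n j]/(unsplit (inr j)) unsplitK.
rewrite bE => c0.
have f0 : f 0 = 0.
  by apply: (addIr (f 0)); rewrite -{1}[f 0]scale1r -lf scale1r !add0r.
have cr j : c (rshift n j) = 0.
  apply: (ie' (fun j => c (rshift n j))).
  have := congr1 g c0; rewrite gD gf add0r (sumE _ _ g lg) -f0 gf => {2}<-.
  by apply: eq_bigr => i _; rewrite sK.
have cl i : c (lshift m i) = 0.
  apply: (ie (fun i => c (lshift m i))); apply: fi; rewrite f0 -[RHS]c0.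
  rewrite [X in _ = _ + X]big1 ?addr0 // => j _.
  by rewrite cr scale0r.
by move=> i; rewrite -(splitK i); case: (split i) => j /=.
Qed.

Lemma has_dim0 V n : has_dim V n -> n = 0%N <-> (forall x : V, x = 0).
Proof.
move=> [e [se ie]]; split=> [n0|V0]; first by subst n => x; have [c ->] := se x; rewrite big_ord0.
case: n e se ie => // n e _ ie; have /(_ ord0)/eqP := ie (fun=> 1) (V0 _).
by rewrite oner_eq0.
Qed.

End Dimension.

Section GrothendieckGroup.
Variables (k : fieldType) (Gam : nmodType) (A : lu_algebra k Gam).
Variables (eps : augmentation A) (B : star_bimod A) (C : serre_subcat eps B).
Implicit Types X Y Z : obj C.

Lemma mhom_linear (R : base_ring k) (M N : amod A R) (f : mhom M N) : linear f.
Proof. by move=> a x y; rewrite homD homZ. Qed.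

Lemma obj_has_dim X : exists n, has_dim (X : lmodType k) n.
Proof. by have [n [e sp]] := sc_fd (obj_in X); apply: (spanning_has_dim sp). Qed.
Definition obj_dim X : nat := projT1 (cid (obj_has_dim X)).
Lemma obj_dimP X : has_dim (X : lmodType k) (obj_dim X).
Proof. exact: (projT2 (cid (obj_has_dim X))). Qed.

Lemma obj_dim_exact X Y Z (f : mhom X Y) (g : mhom Y Z) :
  exact_seq f g -> obj_dim Y = (obj_dim X + obj_dim Z)%N.
Proof.
case=> fi gs ex; apply: has_dim_unique (obj_dimP Y) _.
exact: (has_dim_exact (mhom_linear f) (mhom_linear g) fi gs ex (obj_dimP X) (obj_dimP Z)).
Qed.

Lemma Krel_family h : Krel h -> exists n (c : nat -> int) (X : nat -> obj C),
  (forall W, h W = \sum_(i < n) c i * cls (X i) W) /\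
  \sum_(i < n) c i * (obj_dim (X i))%:Z = 0.
Proof.
elim=> [|c X Y Z f g {}h ex _ [n [c' [X' [hE dE]]]]].
  by exists 0%N, (fun=> 0), (fun=> Obj (sc_unit C)); split=> [W|]; rewrite big_ord0.
exists n.+3, (fun i => match i with 0 => c | 1 => - c | 2 => - c | i.+3 => c' i end).
exists (fun i => match i with 0 => Y | 1 => X | 2 => Z | i.+3 => X' i end).
split=> [W|]; rewrite !big_ord_recl /=; first by rewrite hE !mulrBr !mulNr !addrA.
rewrite dE (obj_dim_exact ex) PoszD addr0 mulrDr !mulNr.
by rewrite addrACA subrr add0r subrr.
Qed.

Lemma cls_family_eq0 n (c : nat -> int) (X : nat -> obj C) (d : obj C -> int) :
  (forall W, \sum_(i < n) c i * cls (X i) W = 0) -> \sum_(i < n) c i * d (X i) = 0.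
Proof.
move=> h; pose p (i : 'I_n) := [pick j : 'I_n | `[< X j = X i >]].
rewrite (partition_big p xpredT) //= big1 // => -[j|] _; last first.
  rewrite big_pred0 // => i; apply/eqP; rewrite /p; case: pickP => // /(_ i).
  by move/negbT/asboolPn.
have [[i0 /eqP pi0]|none] := pselect (exists i, p i == Some j); last first.
  by rewrite big_pred0 // => i; apply/negbTE/negP => pij; apply: none; exists i.
have pE i : (p i == Some j) = `[< X j = X i >].
  have ji0 : X j = X i0.
    by move: pi0; rewrite /p; case: pickP => // l /asboolP lE [<-].
  apply/eqP/asboolP => [|ji].
    by rewrite /p; case: pickP => // l /asboolP lE [<-].
  by rewrite -pi0; apply: eq_pick => l; rewrite -ji -ji0.
transitivity ((\sum_(i < n) c i * cls (X i) (X j)) * d (X j)); last by rewrite h mul0r.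
rewrite mulr_suml.
rewrite [LHS]big_mkcond /=; apply: eq_bigr => i _; rewrite pE /cls.
by case: asboolP => [->|_]; rewrite ?mulr1 // mulr0 mul0r.
Qed.

Lemma Keq_cls0 X : Keq (cls X) (fun=> 0) -> forall x : X, x = 0.
Proof.
move=> /Krel_family [n [c [Y [clsE dE]]]].
apply/(has_dim0 (obj_dimP X)).
pose c' i := if i is i'.+1 then c i' else -1.
pose Y' i := if i is i'.+1 then Y i' else X.
have := @cls_family_eq0 n.+1 c' Y' (fun Z => (obj_dim Z)%:Z).
rewrite big_ord_recl /= dE addr0 mulN1r => /(_ _)/eqP; rewrite oppr_eq0 => H.
apply/eqP; rewrite -eqz_nat; apply: H => W.
by rewrite big_ord_recl /= -clsE subr0 mulN1r addNr.
Qed.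

Lemma Krel_D (f g : obj C -> int) : Krel f -> Krel g -> Krel (fun W => f W + g W).
Proof.
move=> + Kg; elim=> [|c X Y Z u v h ex _ ih].
  by have := Kg; congr Krel; apply/funext => W; rewrite add0r.
by have := Krel_exact c ex ih; congr Krel; apply/funext => W; rewrite addrA.
Qed.

Lemma Keq_exact (c : int) X Y Z (f : mhom X Y) (g : mhom Y Z) : exact_seq f g ->
  Krel (fun W => c * (cls Y W - cls X W - cls Z W)).
Proof.
move=> ex; have := Krel_exact c ex (Krel_0 C); congr Krel; apply/funext => W.
by rewrite addr0.
Qed.

Lemma Keq_zero X : (forall x : X, x = 0) -> Keq (cls X) (fun=> 0).
Proof.
move=> X0; have ex : exact_seq (hid X) (hid X).
  split=> // [y|y]; first by exists y.
  by split=> _; [exists y | exact: X0].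
have := Keq_exact (-1) ex; rewrite /Keq; congr Krel.
by apply/funext => W; rewrite subrr sub0r mulrNN mul1r subr0.
Qed.

Lemma Keq_exact_kernel0 X Y Z (f : mhom X Y) (g : mhom Y Z) : exact_seq f g ->
  (forall x : X, x = 0) -> Keq (cls Y) (cls Z).
Proof.
move=> /(Keq_exact 1) K1 /Keq_zero K2; have := Krel_D K1 K2; rewrite /Keq; congr Krel.
by apply/funext => W; rewrite mul1r subr0 addrAC subrK.
Qed.

Lemma Keq_cokernel X Y Z Z' (f : mhom X Y) (g : mhom Y Z) (g' : mhom Y Z') :
  exact_seq f g -> exact_seq f g' -> Keq (cls Z) (cls Z').
Proof.
move=> /(Keq_exact (-1)) K1 /(Keq_exact 1) K2; have := Krel_D K1 K2.
rewrite /Keq; congr Krel; apply/funext => W.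
by rewrite mul1r mulN1r opprB addrA subrK.
Qed.

End GrothendieckGroup.

(** * Ends of an exhaustive separated filtration *)

Lemma int_boundary (P : int -> Prop) lo hi :
  (forall n, P (n + 1) -> P n) -> P lo -> ~ P hi ->
  exists n, [/\ P n, ~ P (n + 1) & forall m, P m <-> m <= n].
Proof.
move=> Pdecr Plo Phi.
have PB n i : P (n + i%:Z) -> P n.
  elim: i => [|i ih]; first by rewrite addr0.
  by rewrite -addn1 PoszD addrA => /Pdecr.
have Ple m n : m <= n -> P n -> P m.
  by move=> mn; rewrite -(subrK m n) addrC -[n - m]gez0_abs ?subr_ge0 //; apply: PB.
have lohi : lo <= hi by rewrite leNgt; apply/negP => /ltW /Ple /(_ Plo).
have ex : exists i : nat, `[< ~ P (lo + i%:Z) >].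
  exists `|hi - lo|%N; apply/asboolP.
  by rewrite gez0_abs ?subr_ge0 // addrCA subrr addr0.
case: (ex_minnP ex) => -[|i] /asboolP Pi imin; first by rewrite addr0 in Pi.
have Pn : P (lo + i%:Z).
  by apply: contrapT => /asboolP /imin; rewrite ltnn.
have Pn1 : ~ P (lo + i%:Z + 1) by move: Pi; rewrite -addn1 PoszD addrA.
exists (lo + i%:Z); split=> // m; split=> [Pm|/Ple]; last by apply.
by rewrite leNgt; apply/negP => nm; apply/Pn1/(Ple _ m) => //; rewrite lezD1.
Qed.

Section FullSubmodule.
Variables (k : fieldType) (Gam : nmodType) (A : lu_algebra k Gam) (R : base_ring k).
Variables (M : amod A R) (N : submod M) (NT : forall x, N x).
Let inN x : sub_pred N x. Proof. exact/asboolP. Qed.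
Definition into_full_fun x : sub_amod N := exist _ x (inN x).
Fact into_fullD x y : into_full_fun (x + y) = into_full_fun x + into_full_fun y.
Proof. exact: val_inj. Qed.
Fact into_fullZ r x : into_full_fun (r *: x) = bm_id R r *: into_full_fun x.
Proof. exact: val_inj. Qed.
Fact into_fullA a x : into_full_fun (act a x) = act a (into_full_fun x).
Proof. exact: val_inj. Qed.
Definition into_full : mhom M (sub_amod N) := Hom into_fullD into_fullZ into_fullA.
End FullSubmodule.

Section FiltrationEnds.
Variables (k : fieldType) (Gam : nmodType) (A : lu_algebra k Gam).
Variables (eps : augmentation A) (B : star_bimod A) (C : serre_subcat eps B).
Variables (M : obj C) (F : int -> submod M).

Definition graded_piece n : obj C :=
  @quo_obj _ _ _ _ _ C (@sub_obj _ _ _ _ _ C M (F n)) (sub_in (F n) (F (n + 1))).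

Lemma graded_piece_occurs n :
  occurs (fun n => cls (graded_piece n)) n <-> ~ forall x, F n x -> F (n + 1) x.
Proof.
split=> occ h; [apply: occ | apply: occ => x Fx].
  apply: Keq_zero => y; rewrite -[y]lprojK -[0]lproj0.
  apply/lprojP/span_gen; rewrite subr0.
  by apply/h/asboolP; exact: (valP (lrepr y)).
have Fx' : sub_pred (F n) x by apply/asboolP.
have := Keq_cls0 h (quo_proj _ (exist _ x Fx' : sub_amod (F n))).
rewrite -[0]lproj0 => /lprojP/span_sub.
by rewrite subr0.
Qed.

Hypothesis F_decr : forall n x, F (n + 1) x -> F n x.
Hypothesis F_full : exists n, forall x, F n x.
Hypothesis F_zero : exists n, forall x, F n x -> x = 0.
Hypothesis M_neq0 : ~ forall x : M, x = 0.

Lemma highest_power_submod : exists n,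
  highest_power (fun n => cls (graded_piece n)) n /\
  exists N : submod M, Keq (cls (sub_obj N)) (cls (graded_piece n)).
Proof.
have [lo Flo] := F_full; have [hi Fhi] := F_zero.
have [|||n [Pn Pn1 Pm]] :=
  @int_boundary (fun n => ~ forall x, F n x -> x = 0) lo hi; last first.
- have Fn1 x : F (n + 1) x -> x = 0 by move/contrapT: Pn1; apply.
  exists n; split.
    split=> [|m /graded_piece_occurs occ].
      by apply/graded_piece_occurs => h; apply: Pn => x /h; apply: Fn1.
    by apply/Pm => Fm; apply: occ => x /Fm ->; apply: sub_0.
  exists (F n).
  pose K := @sub_obj _ _ _ _ _ C (sub_obj (F n)) (sub_in (F n) (F (n + 1))).
  apply: (@Keq_exact_kernel0 _ _ _ _ _ C K (sub_obj (F n)) (graded_piece n)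
    (sub_incl _) (quo_proj _) (sub_exact _)).
  move=> x; apply: val_inj; apply: val_inj; apply: Fn1.
  by apply/asboolP; exact: (valP x).
- by move=> h; apply: h.
- by move=> h; apply: M_neq0 => x; apply: h.
- by move=> m h h'; apply: h => x /F_decr; apply: h'.
Qed.

Lemma lowest_power_quotient : exists n,
  lowest_power (fun n => cls (graded_piece n)) n /\
  exists N : submod M, Keq (cls (quo_obj N)) (cls (graded_piece n)).
Proof.
have [lo Flo] := F_full; have [hi Fhi] := F_zero.
have [|||n [Pn Pn1 Pm]] :=
  @int_boundary (fun n => forall x, F n x) lo hi; last first.
- exists n; split.
    split=> [|m /graded_piece_occurs occ].
      by apply/graded_piece_occurs => h; apply: Pn1 => x; apply: h.
    rewrite leNgt; apply/negP => mn; apply: occ => x _.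
    by apply: (proj2 (Pm (m + 1))); rewrite lezD1.
  exists (F (n + 1)).
  apply: (@Keq_cokernel _ _ _ _ _ C (sub_obj (F (n + 1))) M (quo_obj (F (n + 1))) (graded_piece n)
    (sub_incl _) (quo_proj _) (hcomp (quo_proj _) (into_full Pn)) (sub_exact _)).
  split=> [|y|y]; first exact: val_inj.
    exists (val (lrepr y)); rewrite -[RHS]lprojK; congr lproj.
    exact: val_inj.
  split=> [|[x ->]].
    move=> y0; have /lprojP/span_sub : quo_proj (sub_in (F n) (F (n + 1))) (into_full Pn y) =
      lproj (sub_in (F n) (F (n + 1))) 0 by rewrite lproj0.
    rewrite subr0 => Fy.
    have Fy' : sub_pred (F (n + 1)) y by apply/asboolP.
    by exists (exist _ y Fy').
  rewrite -[RHS]lproj0; apply/lprojP/span_gen; rewrite subr0.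
  by apply/asboolP; exact: (valP x).
- by move=> h; apply: M_neq0 => x; apply: Fhi.
- exact: Flo.
- by move=> m h x; apply: F_decr.
Qed.
End FiltrationEnds.

Theorem theorem1p5 (k : fieldType) (Gam : nmodType) (A : lu_algebra k Gam)
  (eps : augmentation A) (B : star_bimod A)
  (Co : constraints eps B) (HCo : coherent Co)
  (C : serre_subcat eps B) (J : pred int) (PBW : pbw_theory C J)
  (D : gc_deformation (pbw_L PBW)) (Rm : r_matrices D)
  (al : idx J -> idx J -> nat) (Hal : is_alpha Rm al)
  (Hcons : consistent Rm Co)
  (d : tuples J) (e : seq (idx J)) (He : in_shape d e)
  (p : moves al (seq_s d) e) (q : moves al e (seq_c d)) :
  let M := star_seq_obj (pbw_L PBW) e in
  let Mt := tclass Rm Co p q in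
  (exists n : int, highest_power Mt n /\
     exists N : submod M, Keq (cls (sub_obj N)) (Mt n)) /\
  (exists n : int, lowest_power Mt n /\
     exists N : submod M, Keq (cls (quo_obj N)) (Mt n)).
Proof.
have decr := @jantzen_decr _ _ _ _ _ _ _ _ _ Rm Co _ _ _ _ p q.
have full := jantzen_full Co Hal p q.
have zero := jantzen_zero Co Hal p q.
have M_neq0 : ~ forall x : star_seq_obj (pbw_L PBW) e, x = 0.
  move=> /(star_seq_eq0_moves Co Hal p) es0.
  have [f [fs _]] := pbw_headP PBW d; have [[x x0] _] := pbw_head_simple PBW d.
  by apply: x0; have [y <-] := fs x; rewrite (es0 y : y = 0) hom0.
split; first exact: highest_power_submod decr full zero M_neq0.
exact: lowest_power_quotient decr full zero M_neq0.
Qed.
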